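(* Let $K=F(x)$, the equation $\delta_x^2Y-qY=0$ with $q\in K$, the PPV-groups $H=\mathrm{Gal}_\Delta(M/K)$ (assumed not reductive) and $H'=\mathrm{Gal}_{\Delta'}(M'/K)$, the groups $A,B,A',B'$, and the set $\Pi'$ (a commuting $F$-basis of $\mathcal{L}=\{\partial\in F\cdot\Pi \mid \partial a=0\ \forall a\in A\}$) be as defined in the context. Then: (1) the maximal reductive quotient $H'/R_u(H')\simeq A'$ is $\Pi'$-constant, i.e. $\partial' a=0$ for every $a\in A'$ and every $\partial'\in\Pi'$; (2) if $\mathbf{p}_1,\dots,\mathbf{p}_s\in F[\Pi']$ are defining operators for $R_u(H')$, i.e. $B'=\{b\in F \mid \mathbf{p}_i(b)=0,\ 1\le i\le s\}$, then, viewed in $F[\Pi]$ via the natural inclusion $F[\Pi']\subseteq F[\Pi]$, they are also defining operators for $R_u(H)$, i.e. $B=\{b\in F \mid \mathbf{p}_i(b)=0,\ 1\le i\le s\}$.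
   Context: All fields have characteristic zero. Let $\Pi=\{\partial_1,\dots,\partial_m\}$ be a finite set of commuting derivations and let $F$ be a $\Pi$-closed $\Pi$-field (every system of polynomial $\Pi$-differential equations over $F$ having a solution in some $\Pi$-field extension of $F$ has one in $F$). Let $K=F(x)$ be the $\Delta$-field with $\Delta=\{\delta_x\}\cup\Pi$, commuting derivations, $\delta_x x=1$, $K^{\delta_x}=F$, $\partial_i x=0$ for all $i$. For a $\Delta$-field extension $M\supseteq K$ and $y_1,\dots,y_n\in M$, $K\langle y_1,\dots,y_n\rangle_\Delta$ is the $\Delta$-subfield generated by the $y_i$ over $K$. $F[\Pi]$ is the ring of linear differential operators in $\Pi$ with coefficients in $F$. PPV-extension/group: for a linear equation $\delta_x^nY+\sum_{i<n} r_i\delta_x^iY=0$ with $r_i\in K$, a PPV-extension is a $\Delta$-field extension $M\supseteq K$ with $M=K\langle y_1,\dots,y_n\rangle_\Delta$ for some $F$-linearly independent solutions $y_1,\dots,y_n$, and $M^{\delta_x}=K^{\delta_x}$; it exists and is unique up to $K$-$\Delta$-isomorphism. The PPV-group $\mathrm{Gal}_\Delta(M/K)$ is the group of $\Delta$-automorphisms of $M$ over $K$; acting on the solution space with a chosen basis, it is identified with a linear differential algebraic group, i.e. a subgroup of $\mathrm{GL}_n(F)$ defined by polynomial $\Pi$-differential equations over $F$ in the matrix entries. The unipotent radical $R_u(G)$ is the maximal normal unipotent differential algebraic subgroup of $G$, and $G$ is reductive if $R_u(G)$ is trivial. A linear differential algebraic group is $\Pi$-constant if it is conjugate to a subgroup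 of $\mathrm{GL}_n(F^\Pi)$, where $F^\Pi$ is the field of $\Pi$-constants of $F$. Let $q\in K$, let $M$ be a PPV-extension of $K$ for $\delta_x^2Y-qY=0$, and $H=\mathrm{Gal}_\Delta(M/K)$. Assume $H$ is not reductive. Then there is an $F$-basis $\{\eta,\xi\}$ of the solution space such that $\delta_x\eta=u\eta$ for some $u\in K$ and $\delta_x(\xi/\eta)=\eta^{-2}$; the embedding $H\hookrightarrow\mathrm{SL}_2(F)$ is given by $\sigma(\eta)=a_\sigma\eta$, $\sigma(\xi)=a_\sigma^{-1}\xi+b_\sigma\eta$; and there are differential algebraic subgroups $A\le\mathbb{G}_m(F)$ and $B\le\mathbb{G}_a(F)$ such that the image of $H$ is $$\left\{\begin{pmatrix} a & b\\ 0& a^{-1}\end{pmatrix} : a\in A,\ b\in B\right\}.$$ Such a basis is fixed. Under these identifications $R_u(H)\simeq B$ and $H/R_u(H)\simeq A$. Let $\mathcal{D}=F\cdot\Pi$ be the $F$-linear span of $\Pi$, whose elements act as derivations on $M$ commuting with $\delta_x$, and let $\mathcal{L}=\{\partial\in\mathcal{D} \mid \partial a=0\ \forall a\in A\}$, an $F$-subspace closed under the Lie bracket. Let $\Pi'=\{\partial_1',\dots,\partial_k'\}$ be a commuting $F$-basis of $\mathcal{L}$ (one exists), $F[\Pi']\subseteq F[\Pi]$ the corresponding ring of operators, and $\Delta'=\{\delta_x\}\cup\Pi'$. Regard $K$ as a $\Delta'$-field. Then $M'=K\langle\eta,\xi\rangle_{\Delta'}\subseteq M$ is a PPV-extension of $K$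 for $\delta_x^2Y-qY=0$ with respect to $\Delta'$; put $H'=\mathrm{Gal}_{\Delta'}(M'/K)$, identified with a $\Pi'$-differential algebraic subgroup of $\mathrm{SL}_2(F)$ via the same basis $\{\eta,\xi\}$, and define $A'\le\mathbb{G}_m(F)$, $B'\le\mathbb{G}_a(F)$ for $H'$ in the same way as $A,B$ for $H$, so that $R_u(H')\simeq B'$ and $H'/R_u(H')\simeq A'$. *)

(* Defs.v *)
From mathcomp Require Import all_boot all_order all_algebra.
From mathcomp Require Import mpoly.
Set Implicit Arguments.
Unset Strict Implicit.
Unset Printing Implicit Defensive.
Import GRing.Theory.
Local Open Scope ring_scope.

(* A differential field is a field [E] with a family [d : I -> E -> E] of
   commuting derivations.  Pi is indexed by ['I_m], and {delta_x} \cup Pi by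
   [option 'I_m], where [None] stands for delta_x. *)
Definition derivation (E : fieldType) (D : E -> E) : Prop :=
  (forall a b, D (a + b) = D a + D b) /\
  (forall a b, D (a * b) = D a * b + a * D b).

Definition commuting_derivations (I : Type) (E : fieldType)
    (d : I -> E -> E) : Prop :=
  (forall i, derivation (d i)) /\ (forall i j a, d i (d j a) = d j (d i a)).

Definition diff_compatible (I : Type) (E E' : fieldType) (d : I -> E -> E)
    (d' : I -> E' -> E') (f : E -> E') : Prop :=
  forall i a, f (d i a) = d' i (f a).

(* Differential polynomial expressions over [F] in the unknowns [V]: their
   values are exactly those of the elements of the ring of differential
   polynomials F{V}. *)
Inductive dpoly (F : fieldType) (I V : Type) : Type :=
  | DVar of V
  | DConst of F
  | DAdd of dpoly F I V & dpoly F I V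
  | DMul of dpoly F I V & dpoly F I V
  | DDer of I & dpoly F I V.

Fixpoint deval (F : fieldType) (I V : Type) (E : fieldType) (f : F -> E)
    (d : I -> E -> E) (y : V -> E) (t : dpoly F I V) : E :=
  match t with
  | DVar v => y v
  | DConst c => f c
  | DAdd t1 t2 => deval f d y t1 + deval f d y t2
  | DMul t1 t2 => deval f d y t1 * deval f d y t2
  | DDer i t1 => d i (deval f d y t1)
  end.

Definition dsolution (F : fieldType) (I V : Type) (E : fieldType) (f : F -> E)
    (d : I -> E -> E) (S : dpoly F I V -> Prop) (y : V -> E) : Prop :=
  forall t, S t -> deval f d y t = 0.

Definition diff_closed (I : Type) (F : fieldType) (d : I -> F -> F) : Prop :=
  forall (n : nat) (S : dpoly F I 'I_n -> Prop),
    (exists (E : fieldType) (dE : I -> E -> E) (f : {rmorphism F -> E}),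
       [/\ commuting_derivations dE, diff_compatible d dE f &
           exists y : 'I_n -> E, dsolution f dE S y]) ->
    exists y : 'I_n -> F, dsolution id d S y.

Notation ratfield F := {fraction {poly F}}.

Definition ratC (F : fieldType) (a : F) : ratfield F := tofrac a%:P.

Definition ratX (F : fieldType) : ratfield F := tofrac 'X.

Definition is_ratfield_der (m : nat) (F : fieldType) (dF : 'I_m -> F -> F)
    (dK : option 'I_m -> ratfield F -> ratfield F) : Prop :=
  [/\ commuting_derivations dK,
      forall i a, dK (Some i) (ratC a) = ratC (dF i a),
      dK None (ratX F) = 1,
      forall i, dK (Some i) (ratX F) = 0 &
      forall z, dK None z = 0 <-> exists a, z = ratC a].

Definition dsubfield (I : Type) (M : fieldType) (dM : I -> M -> M)
    (P : M -> Prop) : Prop :=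
  [/\ P 1, forall a b, P a -> P b -> P (a - b),
      forall a b, P a -> P b -> P (a / b) &
      forall i a, P a -> P (dM i a)].

Definition dgenerated (I V : Type) (K M : fieldType) (iM : K -> M)
    (dM : I -> M -> M) (y : V -> M) (z : M) : Prop :=
  forall P : M -> Prop, dsubfield dM P ->
    (forall a, P (iM a)) -> (forall v, P (y v)) -> P z.

Section Extensions.
Variables (m : nat) (F : fieldType) (M : fieldType).
Variables (dK : option 'I_m -> ratfield F -> ratfield F).
Variables (iM : ratfield F -> M) (dM : option 'I_m -> M -> M).

Definition lin_solution (n : nat) (r : 'I_n -> ratfield F) (Y : M) : Prop :=
  iter n (dM None) Y + \sum_(i < n) iM (r i) * iter i (dM None) Y = 0.

Definition F_independent (n : nat) (y : 'I_n -> M) : Prop :=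
  forall c : 'I_n -> F,
    \sum_i iM (ratC (c i)) * y i = 0 -> forall i, c i = 0.

Definition is_PPV (n : nat) (r : 'I_n -> ratfield F) : Prop :=
  [/\ commuting_derivations dM,
      diff_compatible dK dM iM,
      exists y : 'I_n -> M,
        [/\ forall i, lin_solution r (y i), F_independent y &
            forall z, dgenerated iM dM y z] &
      forall z, dM None z = 0 <-> exists f, dK None f = 0 /\ z = iM f].

Definition solution_basis (n : nat) (r : 'I_n -> ratfield F)
    (y : 'I_n -> M) : Prop :=
  [/\ forall i, lin_solution r (y i), F_independent y &
      forall Y, lin_solution r Y ->
        exists c : 'I_n -> F, Y = \sum_i iM (ratC (c i)) * y i].

(* The matrix group attached to Gal_Delta(M/K) and [y]: the [j]-th column of
   [g] contains the coordinates of the image of [y j], so that (a b; 0 a^-1)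
   is the matrix of eta |-> a eta, xi |-> a^-1 xi + b eta. *)
Definition gal_matrices (n : nat) (y : 'I_n -> M) (g : 'M[F]_n) : Prop :=
  exists s : {rmorphism M -> M},
    [/\ bijective s, diff_compatible dM dM s, forall f, s (iM f) = iM f &
        forall j, s (y j) = \sum_i iM (ratC (g i j)) * y i].

End Extensions.

Definition is_ldag (I : Type) (F : fieldType) (d : I -> F -> F) (n : nat)
    (G : 'M[F]_n -> Prop) : Prop :=
  [/\ forall g, G g -> g \in unitmx,
      G 1%:M,
      forall g h, G g -> G h -> G (g *m h),
      forall g, G g -> G (invmx g) &
      exists S : dpoly F I ('I_n * 'I_n) -> Prop,
        forall g, g \in unitmx ->
          (G g <-> dsolution id d S (fun v => g v.1 v.2))].

Definition is_normal_unipotent (I : Type) (F : fieldType) (d : I -> F -> F)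
    (n : nat) (G R : 'M[F]_n -> Prop) : Prop :=
  [/\ is_ldag d R, forall g, R g -> G g,
      forall g h, G g -> R h -> R (g *m h *m invmx g) &
      forall g, R g -> (g - 1%:M) ^+ n = 0].

Definition is_unipotent_radical (I : Type) (F : fieldType) (d : I -> F -> F)
    (n : nat) (G R : 'M[F]_n -> Prop) : Prop :=
  is_normal_unipotent d G R /\
  (forall R', is_normal_unipotent d G R' -> forall g, R' g -> R g).

Definition reductive (I : Type) (F : fieldType) (d : I -> F -> F) (n : nat)
    (G : 'M[F]_n -> Prop) : Prop :=
  is_unipotent_radical d G (fun g => g = 1%:M).

Definition is_Gm_subgroup (I : Type) (F : fieldType) (d : I -> F -> F)
    (A : F -> Prop) : Prop :=
  is_ldag d (fun g : 'M[F]_1 => A (g 0 0)).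

Definition is_Ga_subgroup (I : Type) (F : fieldType) (d : I -> F -> F)
    (B : F -> Prop) : Prop :=
  [/\ B 0, forall a b, B a -> B b -> B (a - b) &
      exists S : dpoly F I unit -> Prop,
        forall b, B b <-> dsolution id d S (fun=> b)].

Definition tri_mx (F : fieldType) (a b : F) : 'M[F]_2 :=
  block_mx (a%:M : 'M_1) (b%:M : 'M_1) 0 (a^-1%:M : 'M_1).

(* For a group [G] of matrices (a b; 0 a^-1): the group of the diagonal entries
   [a], i.e. G / R_u(G), and the group of the [b] with (1 b; 0 1) in [G], i.e.
   R_u(G).  When [G] is the set of all [tri_mx a b] with [a] in [A] and [b] in
   [B], these are [A] and [B]. *)
Definition diag_part (F : fieldType) (G : 'M[F]_2 -> Prop) (a : F) : Prop :=
  exists b, G (tri_mx a b).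

Definition unip_part (F : fieldType) (G : 'M[F]_2 -> Prop) (b : F) : Prop :=
  G (tri_mx 1 b).

Definition is_triangular_product (I : Type) (F : fieldType) (d : I -> F -> F)
    (G : 'M[F]_2 -> Prop) (A B : F -> Prop) : Prop :=
  [/\ is_Gm_subgroup d A, is_Ga_subgroup d B &
      forall g, G g <-> exists a b, [/\ A a, B b & g = tri_mx a b]].

(* An element \sum_i c_i \partial_i of F.Pi is given by its row of
   coefficients; over a differentially closed field, Pi is F-independent, so
   that these are unique.  A family of [k] elements is a matrix [P]. *)
Definition der_comb (m k : nat) (F : fieldType) (P : 'M[F]_(k, m))
    (E : fieldType) (f : F -> E) (d : 'I_m -> E -> E) (j : 'I_k) (a : E) : E :=
  \sum_i f (P j i) * d i a.

Definition der_comb_x (m k : nat) (F : fieldType) (P : 'M[F]_(k, m))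
    (E : fieldType) (f : F -> E) (d : option 'I_m -> E -> E)
    (o : option 'I_k) : E -> E :=
  if o is Some j then der_comb P f (fun i => d (Some i)) j else d None.

Definition annihilating_der (m : nat) (F : fieldType) (d : 'I_m -> F -> F)
    (A : F -> Prop) (c : 'rV[F]_m) : Prop :=
  forall a, A a -> \sum_i c 0 i * d i a = 0.

Definition commuting_basis (m k : nat) (F : fieldType) (d : 'I_m -> F -> F)
    (L : 'rV[F]_m -> Prop) (P : 'M[F]_(k, m)) : Prop :=
  [/\ row_free P, forall c, L c <-> (c <= P)%MS &
      commuting_derivations (der_comb P id d)].

Definition iter_multi (k : nat) (T : Type) (D : 'I_k -> T -> T)
    (al : 'X_{1..k}) (t : T) : T :=
  foldr (fun i => iter (al i) (D i)) t (enum 'I_k).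

(* The polynomial \sum_al c_al 'X^al encodes the operator \sum_al c_al d^al of
   F[Pi].  Only the left F-module structure of [{mpoly F[k]}] is that of F[Pi]:
   the product of F[Pi] is not the product of polynomials. *)
Definition op_apply (k : nat) (F : fieldType) (d : 'I_k -> F -> F)
    (p : {mpoly F[k]}) (b : F) : F :=
  \sum_(al <- msupp p) p@_al * iter_multi d al b.

(* The product d_i p in F[Pi], from d_i c = c d_i + d_i(c) for [c] in [F]. *)
Definition op_lmul (k : nat) (F : fieldType) (d : 'I_k -> F -> F) (i : 'I_k)
    (p : {mpoly F[k]}) : {mpoly F[k]} :=
  map_mpoly (d i) p + 'X_i * p.

(* The inclusion F[Pi'] -> F[Pi], for Pi' given by the rows of [P]: the image of
   a monomial in Pi' is an iterated product, in F[Pi], of the operators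
   \sum_i P_ji d_i. *)
Definition op_incl (m k : nat) (F : fieldType) (d : 'I_m -> F -> F)
    (P : 'M[F]_(k, m)) (p : {mpoly F[k]}) : {mpoly F[m]} :=
  \sum_(al <- msupp p)
    p@_al *: iter_multi (fun j t => \sum_i P j i *: op_lmul d i t) al 1.

Definition defining_operators (k : nat) (F : fieldType) (d : 'I_k -> F -> F)
    (B : F -> Prop) (s : nat) (p : 'I_s -> {mpoly F[k]}) : Prop :=
  forall b, B b <-> forall i, op_apply d (p i) b = 0.

Definition coefs2 (F : fieldType) (q : ratfield F) : 'I_2 -> ratfield F :=
  tnth [tuple - q; 0].

Definition pair2 (M : Type) (eta xi : M) : 'I_2 -> M := tnth [tuple eta; xi].

(* [j] identifies the differential field [L] with the differential subfield of
   [M] generated by the [y v] over [K]. *)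
Definition is_dgenerated_subfield (I V : Type) (K M L : fieldType)
    (iM : K -> M) (dM : I -> M -> M) (y : V -> M)
    (iL : K -> L) (dL : I -> L -> L) (j : L -> M) : Prop :=
  [/\ forall a, j (iL a) = iM a,
      diff_compatible dL dM j &
      forall z, (exists w, j w = z) <-> dgenerated iM dM y z].

(* Main.v *)
(* An element z of M outside K is separated by two embeddings f, g of M over K
   into a common differential field: z (x) 1 - 1 (x) z is not nilpotent in
   M (x)_K M, hence avoids some prime differential ideal, and f, g come from the
   two factors.  The matrix (a, b) comparing f and g on (eta, xi) has entries
   constant under delta_x; as F is differentially closed, all its
   Pi-differential relations over F are satisfied by some (a0, b0) in F, which is
   then the matrix of an element of H, and any prescribed Pi-differential
   polynomial not vanishing at (a, b) can be kept nonzero at (a0, b0).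

   Applied to z = d(eta)/eta with d killing A, this gives z in K, which forces
   d(a) = 0 for a in A'.  Applied to z = eta^2 L(xi/eta), with L an operator in
   the derivations killing A such that L(B) = 0, it gives z in K, whence L kills
   B'.  Finally B is stable under multiplication by A, since H is a product of
   sets and a group; conjugating an equation of B by powers of an element a with
   d(a) = a replaces d by d + k, so that the coefficients of the powers of d are
   themselves equations of B.  Thus B is defined by operators in the derivations
   killing A, and B' = B. *)
Require Import Defs.
From HB Require Import structures.
From mathcomp Require Import all_boot all_order all_algebra.
From mathcomp Require Import mpoly.
From mathcomp Require Import boolp classical_sets.
From mathcomp Require Import ring.
Set Implicit Arguments.
Unset Strict Implicit.
Unset Printing Implicit Defensive.
Import GRing.Theory.
Local Open Scope ring_scope.

(** The Galois correspondence is replaced by a pair of embeddings: an element outside K is moved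
    over a larger field of constants, and the move is then brought back to [F]. The delicate point
    is that the two embeddings compare (a, b) with all of [M], while differential closedness only
    controls relations over [F]. What bridges the gap is that [M] and the delta_x-constants of the
    larger field are linearly disjoint over [F], so that relations with coefficients in [M] can be
    specialized as well. The prime ideal comes from Zorn's lemma; characteristic zero enters there
    because the radical of a differential ideal is differential only when integers can be divided
    by. The equations of [B] are a priori nonlinear. They become linear because a polynomial
    vanishing on an additive subgroup vanishes on its span. An automorphism of [M'] is never
    extended to [M]: the inclusion of B' in B is read off the equations of B, and only the opposite
    inclusion uses automorphisms, by restriction. *)

(** * Quotient rings and fields from equivalence relations *)

(** A class is the predicate [e t] itself; extensionality turns equivalence into equality, and
    classical logic supplies the choice structure. The same construction serves for fractions and
    for the tensor square. *)
Lemma quotient_comring (T : Type) (e : T -> T -> Prop) (zero one : T)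
    (add mul : T -> T -> T) (opp : T -> T) :
  (forall x, e x x) -> (forall x y, e x y -> e y x) ->
  (forall y x z, e x y -> e y z -> e x z) ->
  (forall x x' y y', e x x' -> e y y' -> e (add x y) (add x' y')) ->
  (forall x x' y y', e x x' -> e y y' -> e (mul x y) (mul x' y')) ->
  (forall x x', e x x' -> e (opp x) (opp x')) ->
  (forall x y z, e (add x (add y z)) (add (add x y) z)) ->
  (forall x y, e (add x y) (add y x)) ->
  (forall x, e (add zero x) x) -> (forall x, e (add (opp x) x) zero) ->
  (forall x y z, e (mul x (mul y z)) (mul (mul x y) z)) ->
  (forall x y, e (mul x y) (mul y x)) -> (forall x, e (mul one x) x) ->
  (forall x y z, e (mul (add x y) z) (add (mul x z) (mul y z))) ->
  ~ e one zero ->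
  exists (A : comNzRingType) (p : T -> A),
    [/\ forall a, exists x, p x = a, forall x y, p x = p y <-> e x y,
        p one = 1 & [/\ {morph p : x y / add x y >-> x + y},
                        {morph p : x y / mul x y >-> x * y} &
                        {morph p : x / opp x >-> - x}]].
Proof.
move=> exx esym etrans eadd emul eopp addA addC add0 addN mulA mulC mul1 mulD ne.
pose Q := {P : T -> Prop | exists t, P = e t}.
pose p t : Q := exist _ (e t) (ex_intro _ t erefl).
pose r (x : Q) : T := projT1 (cid (projT2 x)).
have pE x y : p x = p y <-> e x y.
  split=> [[->]|exy] //.
  suff E : e x = e y.
    rewrite /p; move: (ex_intro _ _ _); rewrite E => H.
    by congr exist; apply: Prop_irrelevance.
  apply/funext=> z; apply/propext; split; last exact: etrans.
  by apply: etrans; apply: esym.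
have rK x : p (r x) = x.
  rewrite /r; case: cid; case: x => P HP /= t Pt; rewrite /p.
  by subst P; congr exist; apply: Prop_irrelevance.
have er x : e (r (p x)) x by apply/pE; rewrite rK.
have quotW (P : Q -> Prop) : (forall t, P (p t)) -> forall x, P x.
  by move=> H x; rewrite -(rK x).
pose addQ x y := p (add (r x) (r y)); pose mulQ x y := p (mul (r x) (r y)).
pose oppQ x := p (opp (r x)).
have padd x y : addQ (p x) (p y) = p (add x y) by apply/pE/eadd.
have pmul x y : mulQ (p x) (p y) = p (mul x y) by apply/pE/emul.
have popp x : oppQ (p x) = p (opp x) by apply/pE/eopp.
have addQA : associative addQ.
  by do 3!elim/quotW => ?; rewrite !padd; apply/pE.
have addQC : commutative addQ.
  by do 2!elim/quotW => ?; rewrite !padd; apply/pE.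
have add0Q : left_id (p zero) addQ by elim/quotW => ?; rewrite padd; apply/pE.
have addNQ : left_inverse (p zero) oppQ addQ.
  by elim/quotW => ?; rewrite popp padd; apply/pE.
have mulQA : associative mulQ.
  by do 3!elim/quotW => ?; rewrite !pmul; apply/pE.
have mulQC : commutative mulQ.
  by do 2!elim/quotW => ?; rewrite !pmul; apply/pE.
have mul1Q : left_id (p one) mulQ by elim/quotW => ?; rewrite pmul; apply/pE.
have mulQD : left_distributive mulQ addQ.
  by do 3!elim/quotW => ?; rewrite padd !pmul padd; apply/pE.
have neQ : p one <> p zero by move/pE.
pose C := HB.pack_for choiceType Q (gen_eqMixin Q) (gen_choiceMixin Q).
pose Z := HB.pack_for zmodType Q (Choice.class C)
  (GRing.isZmodule.Build C addQA addQC add0Q addNQ).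
have neZ : p one != 0 :> Z by apply/eqP.
pose A := HB.pack_for comNzRingType Q (GRing.Zmodule.class Z)
  (GRing.Zmodule_isComNzRing.Build Z mulQA mulQC mul1Q mulQD neZ).
exists A, p; split=> //; first by move=> a; exists (r a); exact: rK.
by split=> x * /=; rewrite -?padd -?pmul -?popp.
Qed.

Lemma comring_field (A : comNzRingType) :
  (forall a : A, a <> 0 -> exists b, b * a = 1) ->
  exists (E : fieldType) (h : {rmorphism A -> E}), bijective h.
Proof.
move=> inv_ex.
have [inv invP] : {inv : A -> A & forall a, a <> 0 -> inv a * a = 1}.
  apply: (@choice _ _ (fun a b => a <> 0 -> b * a = 1)) => a.
  by have [->|/eqP/inv_ex[b]] := eqVneq a 0; [exists 0 | exists b].
(* The field interface wants the inverse of 0 to be 0, a value that [inv] leaves open. *)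
pose i a := if a == 0 then 0 else inv a.
have mulV a : a != 0 -> i a * a = 1.
  by move=> a0; rewrite /i (negPf a0); apply/invP/eqP.
have i0 : i 0 = 0 by rewrite /i eqxx.
pose E := HB.pack_for fieldType A (GRing.ComNzRing_isField.Build A mulV i0).
pose h : A -> E := id.
have ha : zmod_morphism h by [].
have hm : monoid_morphism h by [].
pose hR := HB.pack_for {rmorphism A -> E} h
  (GRing.isZmodMorphism.Build A E h ha) (GRing.isMonoidMorphism.Build A E h hm).
by exists E, hR; exists h.
Qed.

(** * Differential fields from prime differential ideals *)

Definition ring_derivation (A : comNzRingType) (D : A -> A) : Prop :=
  (forall a b, D (a + b) = D a + D b) /\
  (forall a b, D (a * b) = D a * b + a * D b).

(** The empty set qualifies, so that the union of an empty chain is admissible in Zorn's lemma;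
    membership of 0 is stated separately. *)
Definition diff_ideal (I : Type) (A : comNzRingType) (D : I -> A -> A)
    (J : A -> Prop) : Prop :=
  [/\ forall a b, J a -> J b -> J (a + b), forall c a, J a -> J (c * a) &
      forall i a, J a -> J (D i a)].

(** The fraction field of [A / J] in one step: denominators lie outside [J] and fractions are
    compared modulo [J]. Derivations follow the quotient rule. *)
Lemma fraction_dfield (I : Type) (A : comNzRingType) (D : I -> A -> A)
    (J : A -> Prop) :
  (forall i, ring_derivation (D i)) ->
  (forall i j a, D i (D j a) = D j (D i a)) ->
  diff_ideal D J -> J 0 -> ~ J 1 -> (forall a b, J (a * b) -> J a \/ J b) ->
  exists (E : fieldType) (dE : I -> E -> E) (h : {rmorphism A -> E}),
    [/\ commuting_derivations dE, forall i a, h (D i a) = dE i (h a) &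
        forall a, h a = 0 <-> J a].
Proof.
move=> derD comD [Jadd Jmul JD] J0 J1 Jprime.
pose T := {x : A * A | ~ J x.2}.
pose e (x y : T) := J ((sval x).1 * (sval y).2 - (sval y).1 * (sval x).2).
have JM x y : ~ J x -> ~ J y -> ~ J (x * y) by move=> ? ? /Jprime[].
pose mk (n d : A) (H : ~ J d) : T := exist _ (n, d) H.
pose add (x y : T) := mk ((sval x).1 * (sval y).2 + (sval y).1 * (sval x).2) _
  (JM _ _ (svalP x) (svalP y)).
pose mul (x y : T) := mk ((sval x).1 * (sval y).1) _
  (JM _ _ (svalP x) (svalP y)).
pose opp (x : T) := mk (- (sval x).1) _ (svalP x).
have Jcomb (u v a b c : A) : J u -> J v -> a * u + b * v = c -> J c.
  by move=> ? ? <-; apply: Jadd; apply: Jmul.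
have J0eq a : a = 0 -> J a by move->.
have [|||||||||||||||A' [p [psurj pE p1 [padd pmul popp]]]] :=
    @quotient_comring T e (mk 0 1 J1) (mk 1 1 J1) add mul opp.
- by move=> [[a b] ?]; apply: J0eq; rewrite /= subrr.
- by move=> [[a b] ?] [[c d] ?]; rewrite /e /= => H; apply: (Jcomb _ _ (-1) 0 _ H H) => /=; ring.
- move=> [[c d] nd] [[a b] ?] [[f g] ?]; rewrite /e /= => H K.
  (* Transitivity first holds up to the middle denominator [d], which primeness cancels. *)
  suff /Jprime[] : J (d * (a * g - f * b)) by [].
  by apply: (Jcomb _ _ g b _ H K); ring.
- move=> [[a b] ?] [[a' b'] ?] [[c d] ?] [[c' d'] ?]; rewrite /e /= => H K.
  by apply: (Jcomb _ _ (d * d') (b * b') _ H K); ring.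
- move=> [[a b] ?] [[a' b'] ?] [[c d] ?] [[c' d'] ?]; rewrite /e /= => H K.
  by apply: (Jcomb _ _ (c * d') (a' * b) _ H K); ring.
- move=> [[a b] ?] [[a' b'] ?]; rewrite /e /= => H.
  by apply: (Jcomb _ _ (-1) 0 _ H H); ring.
- by move=> [[? ?] ?] [[? ?] ?] [[? ?] ?]; apply: J0eq => /=; ring.
- by move=> [[? ?] ?] [[? ?] ?]; apply: J0eq => /=; ring.
- by move=> [[? ?] ?]; apply: J0eq => /=; ring.
- by move=> [[? ?] ?]; apply: J0eq => /=; ring.
- by move=> [[? ?] ?] [[? ?] ?] [[? ?] ?]; apply: J0eq => /=; ring.
- by move=> [[? ?] ?] [[? ?] ?]; apply: J0eq => /=; ring.
- by move=> [[? ?] ?]; apply: J0eq => /=; ring.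
- by move=> [[? ?] ?] [[? ?] ?] [[? ?] ?]; apply: J0eq => /=; ring.
- by rewrite /e /= mul0r !mulr1 subr0.
have p0 : p (mk 0 1 J1) = 0.
  have := padd (mk 0 1 J1) (mk 0 1 J1).
  have -> : p (add (mk 0 1 J1) (mk 0 1 J1)) = p (mk 0 1 J1).
    by apply/pE; apply: J0eq => /=; ring.
  by move=> H; apply: (addIr (p (mk 0 1 J1))); rewrite -H add0r.
have [|E [k kbij]] := @comring_field A'.
  move=> x; have [[[a b] H] <-] := psurj x => x0.
  have Ja : ~ J a.
    move=> Ja; apply: x0; rewrite -p0; apply/pE; rewrite /e /=.
    by rewrite mulr1 mul0r subr0.
  exists (p (mk b a Ja)); rewrite -pmul -p1; apply/pE; apply: J0eq => /=; ring.
pose h0 (a : A) := k (p (mk a 1 J1)).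
have h0E a b H : k (p (mk a b H)) * h0 b = h0 a.
  by rewrite /h0 -rmorphM -pmul; congr (k _); apply/pE; apply: J0eq => /=; ring.
have hz : zmod_morphism h0.
  move=> a b; rewrite /h0 -rmorphB -popp -padd; congr (k _).
  by apply/pE; apply: J0eq => /=; ring.
have hm : monoid_morphism h0.
  split=> [|a b]; first by rewrite /h0 p1 rmorph1.
  rewrite /h0 -rmorphM -pmul; congr (k _).
  by apply/pE; apply: J0eq => /=; ring.
pose hR := HB.pack_for {rmorphism A -> E} h0
  (GRing.isZmodMorphism.Build A E h0 hz) (GRing.isMonoidMorphism.Build A E h0 hm).
have [h hE] : exists h : {rmorphism A -> E}, h =1 h0 by exists hR.
have hJ a : h a = 0 <-> J a.
  rewrite hE /h0 -(rmorph0 k) -p0; split.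
    by move/(bij_inj kbij)/pE; rewrite /e /= mul0r mulr1 subr0.
  by move=> ?; congr (k _); apply/pE; rewrite /e /= mul0r mulr1 subr0.
have hsurj z : exists a b, ~ J b /\ z * h b = h a.
  case: kbij => k' kK k'K; rewrite -(k'K z).
  have [[[a b] H] <-] := psurj (k' z).
  by exists a, b; split=> //; rewrite !hE; exact: h0E.
have hnz b : ~ J b -> h b != 0 by move=> ?; apply/eqP => /hJ.
have frac z : {ab : A * A | ~ J ab.2 /\ z * h ab.2 = h ab.1}.
  by apply: cid; have [a [b [? ?]]] := hsurj z; exists (a, b).
pose dE i z := let: (a, b) := sval (frac z) in
  (h (D i a) * h b - h a * h (D i b)) / h b ^+ 2.
(* The quotient rule does not depend on the representative: a d - b c lies in [J], hence so does its
   derivative, which is [E2]. *)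
have dEE i z a b : ~ J b -> z * h b = h a ->
    dE i z = (h (D i a) - z * h (D i b)) / h b.
  move=> Jb zE; rewrite /dE; case: (frac z) => [[c d] /= [Jd zE']].
  have hb := hnz _ Jb; have hd := hnz _ Jd.
  have E1 : h a * h d = h b * h c by rewrite -zE -zE'; ring.
  have E2 : h (D i a) * h d + h a * h (D i d) =
            h (D i b) * h c + h b * h (D i c).
    move: E1; rewrite -!rmorphM; move/eqP; rewrite -subr_eq0 -rmorphB => /eqP.
    move=> /hJ /(JD i); case: (derD i) => dA dM.
    have d0 : D i 0 = 0 by apply: (addIr (D i 0)); rewrite -dA !add0r.
    have dN x : D i (- x) = - D i x.
      by apply: (addIr (D i x)); rewrite -dA !addNr d0.
    rewrite dA dN !dM => /hJ; rewrite rmorphB !rmorphD !rmorphM => /eqP.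
    by rewrite subr_eq0 => /eqP.
  have -> : z = h a / h b by rewrite -zE mulfK.
  have hcE : h c = h a * h d / h b by rewrite E1 mulrC mulKf.
  have hDcE : h (D i c) = (h (D i a) * h d + h a * h (D i d) - h (D i b) * h c) / h b.
    by rewrite E2; field.
  by rewrite hDcE hcE; field; rewrite hb hd.
have dEh i a : dE i (h a) = h (D i a).
  rewrite (@dEE i _ a 1) ?rmorph1 ?mulr1 ?divr1 //.
  case: (derD i) => dA dM; have d1 : D i 1 = 0.
    by apply: (addIr (D i 1)); rewrite -[in RHS](mulr1 1) dM mulr1 mul1r add0r.
  by rewrite d1 rmorph0 mulr0 subr0.
have dEE' i z a b : ~ J b -> z * h b = h a ->
    dE i z * h b = h (D i a) - z * h (D i b).
  by move=> Jb /(dEE i _ _ _ Jb) ->; rewrite divfK ?hnz.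
have derE i : derivation (dE i).
  case: (derD i) => dA dM; split=> z w.
    have [a [b [Jb zE]]] := hsurj z; have [c [d [Jd wE]]] := hsurj w.
    rewrite (@dEE i (z + w) (a * d + c * b) (b * d)); first last.
    - by rewrite rmorphD !rmorphM -zE -wE; ring.
    - exact: (JM b d).
    have := dEE' i _ _ _ Jb zE; have := dEE' i _ _ _ Jd wE.
    rewrite !dA !dM !(rmorphD, rmorphM) -zE -wE => Hw Hz.
    have -> : h (D i a) = dE i z * h b + z * h (D i b) by rewrite Hz; ring.
    have -> : h (D i c) = dE i w * h d + w * h (D i d) by rewrite Hw; ring.
    by field; rewrite !hnz.
  have [a [b [Jb zE]]] := hsurj z; have [c [d [Jd wE]]] := hsurj w.
  rewrite (@dEE i (z * w) (a * c) (b * d)); first last.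
  - by rewrite !rmorphM -zE -wE; ring.
  - exact: (JM b d).
  have := dEE' i _ _ _ Jb zE; have := dEE' i _ _ _ Jd wE.
  rewrite !dM !(rmorphD, rmorphM) -zE -wE => Hw Hz.
  have -> : h (D i a) = dE i z * h b + z * h (D i b) by rewrite Hz; ring.
  have -> : h (D i c) = dE i w * h d + w * h (D i d) by rewrite Hw; ring.
  by field; rewrite !hnz.
exists E, dE, h; split=> //; split=> // i j z.
have [a [b [Jb zE]]] := hsurj z.
have H (l : I) : dE l z * h b + z * dE l (h b) = dE l (h a).
  by rewrite -zE (derE l).2.
(* Two derivations applied to z h(b) = h(a) give mixed terms symmetric in [l] and [l']; commutation
   at z follows on cancelling [h b]. *)
have H2 (l l' : I) : dE l (dE l' z) * h b + dE l' z * dE l (h b) +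
    (dE l z * dE l' (h b) + z * dE l (dE l' (h b))) = dE l (dE l' (h a)).
  by rewrite -[in RHS]H (derE l).1 !(derE l).2.
apply: (mulIf (hnz _ Jb)).
have := H2 i j; have := H2 j i.
rewrite !dEh (comD j i) (comD j i a) => <- /eqP; rewrite -subr_eq0 => /eqP E0.
by apply/eqP; rewrite -subr_eq0 -E0; apply/eqP; ring.
Qed.

(** [J] is maximal among the differential ideals avoiding the powers of [s]. Invertible integers
    make the radical of a differential ideal differential, so [J] is radical; maximality applied to
    saturations then gives primeness. *)
Lemma prime_diff_ideal (I : Type) (A : comNzRingType) (D : I -> A -> A) (s : A) :
  (forall i, ring_derivation (D i)) ->
  (forall n, exists c : A, c * n.+1%:R = 1) -> (forall n, s ^+ n <> 0) ->
  exists J : A -> Prop,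
    [/\ diff_ideal D J, J 0, forall n, ~ J (s ^+ n) &
        forall a b, J (a * b) -> J a \/ J b].
Proof.
move=> derD natV snil.
pose avoid (J : set A) := diff_ideal D J /\ (forall n, ~ J (s ^+ n)).
have [F FP Ftot|J [[JI Jav] Jmax]] := @Zorn_bigcup A avoid.
  split; last by move=> n [X /FP[_ /(_ n)]].
  split=> [a b [X FX Xa] [Y FY Yb]|c a [X FX Xa]|i a [X FX Xa]].
  - have [XY|YX] := Ftot _ _ FX FY.
      by exists Y => //; case: (FP _ FY) => -[+ _ _] _; apply => //; apply: XY.
    by exists X => //; case: (FP _ FX) => -[+ _ _] _; apply => //; apply: YX.
  - by exists X => //; case: (FP _ FX) => -[_ + _] _; apply.
  - by exists X => //; case: (FP _ FX) => -[_ _ +] _; apply.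
have D0 i : D i 0 = 0.
  by case: (derD i) => dA _; apply: (addIr (D i 0)); rewrite -dA !add0r.
(* If 0 were missing, [J] would be empty, as 0 times a member is a member, and the zero ideal would
   be larger. *)
have J0 : J 0.
  apply: contrapT => nJ0; apply: (Jmax (fun x => x = 0)).
    split=> [x Jx|/(_ 0 erefl)//].
    by case: nJ0; case: JI => _ /(_ 0 _ Jx); rewrite mul0r.
  split; last by move=> n; apply: snil.
  split=> [a b -> ->|c a ->|i a ->]; rewrite ?addr0 ?mulr0 //.
have big (X : A -> Prop) x : diff_ideal D X -> (forall y, J y -> X y) ->
    X x -> ~ J x -> exists n, X (s ^+ n).
  move=> XI JX Xx nJx; apply: contrapT => /forallNP Xav.
  by apply: (Jmax X) => //; split=> // /(_ x Xx).
case: JI => Jadd Jmul JD.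
have JmulR a c : J a -> J (a * c) by rewrite mulrC; apply: Jmul.
have D1 i : D i 1 = 0.
  by case: (derD i) => _ dM; apply: (addIr (D i 1)); rewrite -[in RHS](mulr1 1) dM mulr1 mul1r add0r.
have derX i x n : D i (x ^+ n) = n%:R * (x ^+ n.-1 * D i x).
  case: (derD i) => _ dM; elim: n => [|n IH]; first by rewrite D1 mul0r.
  rewrite exprS dM IH -natr1; case: n {IH} => [|n]; rewrite ?exprS /=; ring.
have Jnat n a : J (n.+1%:R * a) -> J a.
  by have [c cE] := natV n => /(Jmul c); rewrite mulrA cE mul1r.
have JN a : J a -> J (- a) by rewrite -mulN1r; apply: Jmul.
have radical x n : J (x ^+ n) -> J x.
  pose X (x : A) := exists n, J (x ^+ n).
  move=> Jxn; apply: contrapT => nJx; have [||||m [k]] := @big X x.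
  - split=> [a b [k Jk] [l Jl]|c a [k Jk]|i a [k Jk]].
    + exists (k + l)%N; rewrite exprDn; elim/big_ind: _ => // i _.
      rewrite -mulr_natl; apply: (Jmul).
      have [li|il] := leqP l i; first by rewrite -(subnK li) exprD mulrA; apply: Jmul.
      have ki : (k <= k + l - i)%N by rewrite -addnBA ?leq_addr // ltnW.
      by rewrite -(subnK ki) exprD mulrAC; apply: Jmul.
    + by exists k; rewrite exprMn; apply: Jmul.
    (* Derive a^(m+1) (D a)^(2l) and multiply by D a: modulo [J] what remains is (m+1) a^m (D
       a)^(2l+2). After k steps, a power of D a is in [J]. *)
    + have H : forall l, (l <= k)%N -> J (a ^+ (k - l) * D i a ^+ l.*2).
        elim=> [|l IH] lk; first by rewrite subn0 mulr1.
        have := IH (ltnW lk); rewrite -subnSK //; move: (k - l.+1)%N => m J1.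
        have /(Jmul (D i a)) J2 := JD i _ J1.
        apply: (@Jnat m); move: J2; rewrite (derD i).2 !derX /=.
        have J3 := JN _ (Jmul (l.*2%:R * D i (D i a)) _ J1).
        move/Jadd => /(_ _ J3); congr J.
        case: l {IH lk J1 J3} => [|l]; rewrite ?double0 ?doubleS ?exprS /=; ring.
      by exists k.*2; rewrite -[X in J X]mul1r -(expr0 a) -(subnn k); exact: H.
  - by move=> y Jy; exists 1%N; rewrite expr1.
  - by exists n.
  - by [].
  - by rewrite -exprM => /Jav.
(* All powers of [b] are allowed so that the saturation is stable under derivation: b D(b^n x)
   involves b^(n+1) D(x). *)
pose colon b (x : A) := exists n, J (b ^+ n * x).
have colonI b : diff_ideal D (colon b).
  split=> [x y [n Jn] [m Jm]|c x [n Jn]|i x [n Jn]].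
  - by exists (n + m)%N; rewrite mulrDr exprD; apply: Jadd;
      [rewrite mulrAC; apply: JmulR | rewrite -mulrA; apply: Jmul].
  - by exists n; rewrite mulrCA; apply: Jmul.
  - exists n.+1; have /(JD i)/(Jmul b) := Jn; rewrite (derD i).2.
    rewrite derX => J1.
    have := Jadd _ _ J1 (JN _ (Jmul (n%:R * D i b) _ Jn)); congr J.
    case: n {Jn J1} => [|n]; rewrite ?exprS /=; ring.
have colonJ b y : J y -> colon b y by exists 0%N; rewrite mul1r.
exists J; split=> // a b Jab; apply: contrapT => /not_orP[nJa nJb].
(* The saturation by [b] contains [a], hence a power of [s]; so the saturation by [s] contains a
   power of [b], which is outside the radical ideal [J]. It then contains a power of [s], and so
   does [J]. *)
have [m [k Jk]] : exists m, colon b (s ^+ m).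
  apply: (big (colon b) a) => //; first exact: colonJ.
  by exists 1%N; rewrite expr1 mulrC.
have [l [n]] : exists n, colon s (s ^+ n).
  apply: (big (colon s) (b ^+ k)) => //; first exact: colonJ.
    by exists m; rewrite mulrC.
  by move/radical.
by rewrite -exprD => /Jav.
Qed.

(** * Separating embeddings from the tensor square *)

Definition semilinear_form (K M : fieldType) (i : K -> M) (lam : M -> K) : Prop :=
  (forall x y, lam (x + y) = lam x + lam y) /\
  (forall c x, lam (i c * x) = c * lam x).

(** Zorn's lemma gives a subspace [W] maximal with z outside [W] + K. It contains 1 and is a
    complement of the line of z; the form is the coordinate along z. *)
Lemma separating_form (K M : fieldType) (i : {rmorphism K -> M}) (z : M) :
  ~ (exists c, z = i c) ->
  exists lam, [/\ semilinear_form i lam, lam 1 = 0 & lam z = 1].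
Proof.
move=> zK.
pose sub (W : set M) := (forall x y, W x -> W y -> W (x + y)) /\
  (forall c x, W x -> W (i c * x)).
pose ok (W : set M) := sub W /\ forall c, ~ W (z - i c).
have [F FP Ftot|W [[[Wadd Wmul] Wz] Wmax]] := @Zorn_bigcup M ok.
  split; last by move=> c [X /FP[_ /(_ c)]].
  split=> [a b [X FX Xa] [Y FY Yb]|c a [X FX Xa]].
  - have [XY|YX] := Ftot _ _ FX FY.
      by exists Y => //; case: (FP _ FY) => -[+ _] _; apply => //; apply: XY.
    by exists X => //; case: (FP _ FX) => -[+ _] _; apply => //; apply: YX.
  - by exists X => //; case: (FP _ FX) => -[_ +] _; apply.
have W0 : W 0.
  apply: contrapT => nW0; apply: (Wmax (fun x => x = 0)).
    split=> [x Wx|/(_ 0 erefl)//].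
    by case: nW0; have := Wmul 0 _ Wx; rewrite rmorph0 mul0r.
  split; first by split=> [x y -> ->|c x ->]; rewrite ?addr0 ?mulr0.
  by move=> c /eqP; rewrite subr_eq0 => /eqP zc; apply: zK; exists c.
have WN x : W x -> W (- x) by move/(Wmul (-1)); rewrite rmorphN1 mulN1r.
have ext x : ~ W x -> exists c d w, W w /\ z - i c = w + i d * x.
  move=> nWx; apply: contrapT => /forallNP nx.
  apply: (Wmax (fun y => exists d w, W w /\ y = w + i d * x)).
    split=> [y Wy|/(_ x)]; first by exists 0, y; rewrite rmorph0 mul0r addr0.
    by move=> H; apply: nWx; apply: H; exists 1, 0; rewrite rmorph1 mul1r add0r.
  split; last by move=> c H; apply: (nx c).
  split=> [y y' [d [w [Ww ->]]] [d' [w' [Ww' ->]]]|c y [d [w [Ww ->]]]].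
    by exists (d + d'), (w + w'); split; [exact: Wadd | rewrite rmorphD; ring].
  by exists (c * d), (i c * w); split; [exact: Wmul | rewrite rmorphM; ring].
have W1 : W 1.
  apply: contrapT => /ext [c [d [w [Ww]]]] /eqP; rewrite subr_eq => /eqP E.
  apply: (Wz (d + c)); rewrite E (_ : _ - _ = w) // rmorphD; ring.
have nWz : ~ W z by have := Wz 0; rewrite rmorph0 subr0.
have coord x : exists c, W (x - i c * z).
  have [Wx|/ext [c [d [w [Ww E]]]]] := pselect (W x).
    by exists 0; rewrite rmorph0 mul0r subr0.
  have d0 : d != 0.
    by apply/eqP => d0; apply: (Wz c); rewrite E d0 rmorph0 mul0r addr0.
  exists d^-1; have id0 : i d != 0 by rewrite fmorph_eq0.
  have -> : x - i d^-1 * z = - (i d^-1 * (i c * 1 + w)).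
    have -> : z = w + i d * x + i c by rewrite -E; ring.
    by rewrite fmorphV; field.
  by apply/WN/Wmul/Wadd => //; apply: Wmul.
have coordU x c d : W (x - i c * z) -> W (x - i d * z) -> c = d.
  move=> /WN Wc Wd; apply: contrapT => /eqP; rewrite -subr_eq0 => cd.
  apply: nWz; have := Wmul (c - d)^-1 _ (Wadd _ _ Wc Wd).
  rewrite (_ : _ * _ = z) //; have : i (c - d) != 0 by rewrite fmorph_eq0.
  by rewrite fmorphV rmorphB => ?; field.
have [lam lamP] := choice coord.
exists lam; split; [split| |] => [x y|c x||]; apply: coordU (lamP _) _.
- rewrite (_ : _ - _ = (x - i (lam x) * z) + (y - i (lam y) * z)).
    exact: Wadd.
  by rewrite rmorphD; ring.
- rewrite (_ : _ - _ = i c * (x - i (lam x) * z)); first exact: Wmul.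
  by rewrite rmorphM; ring.
- by rewrite rmorph0 mul0r subr0.
- by rewrite rmorph1 mul1r subrr.
Qed.

Lemma der0 (E : fieldType) (D : E -> E) : derivation D -> D 0 = 0.
Proof. by case=> dA _; apply: (addIr (D 0)); rewrite -dA !add0r. Qed.

Lemma der1 (E : fieldType) (D : E -> E) : derivation D -> D 1 = 0.
Proof.
case=> _ dM'; apply: (addIr (D 1)).
by rewrite -[in RHS](mulr1 1) dM' mulr1 mul1r add0r.
Qed.

Section TensorSquare.
Variables (I : Type) (K M : fieldType) (i : {rmorphism K -> M}).
Variables (dK : I -> K -> K) (dM : I -> M -> M).
Hypotheses (derK : forall j, derivation (dK j)) (derM : commuting_derivations dM).
Hypothesis compM : diff_compatible dK dM i.

Definition tsum (l : seq (M * M)) (phi : M -> M -> M) : M :=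
  \sum_(p <- l) phi p.1 p.2.

Definition tmul (l l' : seq (M * M)) : seq (M * M) :=
  [seq (p.1 * q.1, p.2 * q.2) | p <- l, q <- l'].

Definition topp (l : seq (M * M)) : seq (M * M) := [seq (- p.1, p.2) | p <- l].

Definition tder j (l : seq (M * M)) : seq (M * M) :=
  [seq (dM j p.1, p.2) | p <- l] ++ [seq (p.1, dM j p.2) | p <- l].

Definition tpair (lam : M -> K) (x y : M) : M := i (lam x) * y.

(** A list of pairs stands for a sum of pure tensors over [K]. Equality is tested by contracting the
    left factor with every K-linear form, since forms separate tensors over a field. *)
Definition teq (l l' : seq (M * M)) : Prop :=
  forall lam, semilinear_form i lam -> tsum l (tpair lam) = tsum l' (tpair lam).

Lemma tsum_cat l l' phi : tsum (l ++ l') phi = tsum l phi + tsum l' phi.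
Proof. by rewrite /tsum big_cat. Qed.

Lemma tsum_mul l l' phi :
  tsum (tmul l l') phi =
  tsum l (fun x y => tsum l' (fun x' y' => phi (x * x') (y * y'))).
Proof. by rewrite /tsum /tmul big_allpairs_dep. Qed.

Lemma tsum_opp l phi : tsum (topp l) phi = tsum l (fun x => phi (- x)).
Proof. by rewrite /tsum big_map. Qed.

Lemma tsum_der j l phi :
  tsum (tder j l) phi = tsum l (fun x y => phi (dM j x) y + phi x (dM j y)).
Proof. by rewrite /tsum big_cat !big_map [RHS]big_split. Qed.

Lemma tsum_add l phi psi :
  tsum l (fun x y => phi x y + psi x y) = tsum l phi + tsum l psi.
Proof. by rewrite /tsum big_split. Qed.

Lemma eq_tsum l phi psi : (forall x y, phi x y = psi x y) ->
  tsum l phi = tsum l psi.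
Proof. by move=> e; apply: eq_bigr => ? _. Qed.

Lemma exchange_tsum l l' (phi : M -> M -> M -> M -> M) :
  tsum l (fun x y => tsum l' (phi x y)) =
  tsum l' (fun x' y' => tsum l (fun x y => phi x y x' y')).
Proof. exact: exchange_big. Qed.

Lemma tsum_derM j l phi : tsum l (fun x y => dM j (phi x y)) = dM j (tsum l phi).
Proof.
rewrite /tsum; elim/big_ind2: _ => //; last by move=> ? ? ? ? -> ->; rewrite (derM.1 j).1.
by rewrite (der0 (derM.1 j)).
Qed.

Lemma tsum_mull l phi c : tsum l (fun x y => c * phi x y) = c * tsum l phi.
Proof. by rewrite /tsum big_distrr. Qed.

Section Form.
Variable lam : M -> K.
Hypothesis lamP : semilinear_form i lam.

Lemma form0 : lam 0 = 0.
Proof. by apply: (addIr (lam 0)); rewrite -lamP.1 !add0r. Qed.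

Lemma formN x : lam (- x) = - lam x.
Proof. by apply: (addIr (lam x)); rewrite -lamP.1 !addNr form0. Qed.

Lemma form_mul m : semilinear_form i (fun x => lam (m * x)).
Proof.
by split=> [x y|c x]; rewrite ?mulrDr ?lamP.1 // mulrCA lamP.2.
Qed.

(** In the commutator of a form with a derivation, the terms where the derivation hits the scalar
    cancel, so K-linearity survives. This is what makes [teq] compatible with [tder]. *)
Lemma form_der j : semilinear_form i (fun x => lam (dM j x) - dK j (lam x)).
Proof.
case: lamP => lA lZ; case: (derM.1 j) => dA dM'; case: (derK j) => kA kM.
split=> [x y|c x]; first by rewrite dA !lA kA; ring.
rewrite dM' lA -compM !lZ kM; ring.
Qed.

Lemma tsum_form_mul l l' :
  tsum (tmul l l') (tpair lam) =
  tsum l (fun x y => y * tsum l' (tpair (fun x' => lam (x * x')))).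
Proof.
rewrite tsum_mul; apply: eq_tsum => x y; rewrite -tsum_mull.
by apply: eq_tsum => x' y'; rewrite /tpair; ring.
Qed.

Lemma tsum_form_der j l :
  tsum (tder j l) (tpair lam) =
  tsum l (tpair (fun x => lam (dM j x) - dK j (lam x))) + dM j (tsum l (tpair lam)).
Proof.
rewrite tsum_der -tsum_derM -tsum_add; apply: eq_tsum => x y.
rewrite /tpair rmorphB compM (derM.1 j).2; ring.
Qed.

End Form.

Lemma tmulC l l' : teq (tmul l l') (tmul l' l).
Proof.
move=> lam _; rewrite !tsum_mul exchange_tsum.
by do 2![apply: eq_tsum => ? ?]; congr tpair; rewrite mulrC.
Qed.

Lemma tmul_compr l l1 l2 : teq l1 l2 -> teq (tmul l l1) (tmul l l2).
Proof.
move=> e lam lamP; rewrite !tsum_form_mul //; apply: eq_tsum => x y.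
by rewrite e //; apply: form_mul.
Qed.

Lemma teq_trans l2 l1 l3 : teq l1 l2 -> teq l2 l3 -> teq l1 l3.
Proof. by move=> e1 e2 lam lamP; rewrite e1 // e2. Qed.

(** Contraction treats the two factors differently; [tmul_compr] handles one argument and
    commutativity carries it to the other. *)
Lemma tmul_comp l1 l1' l2 l2' :
  teq l1 l1' -> teq l2 l2' -> teq (tmul l1 l2) (tmul l1' l2').
Proof.
move=> e1 e2; apply: (teq_trans (tmul_compr _ e2)).
apply: (teq_trans (tmulC _ _)); apply: (teq_trans (tmul_compr _ e1)).
exact: tmulC.
Qed.

Lemma tmulA l1 l2 l3 : tsum (tmul l1 (tmul l2 l3)) =1 tsum (tmul (tmul l1 l2) l3).
Proof.
move=> phi; rewrite !tsum_mul; apply: eq_tsum => x y; rewrite tsum_mul.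
by do 2![apply: eq_tsum => ? ?]; rewrite !mulrA.
Qed.

Lemma tmulDl l1 l2 l3 :
  tsum (tmul (l1 ++ l2) l3) =1 tsum (tmul l1 l3 ++ tmul l2 l3).
Proof. by move=> phi; rewrite tsum_cat !tsum_mul tsum_cat. Qed.

Lemma tder_comp j l l' : teq l l' -> teq (tder j l) (tder j l').
Proof.
move=> e lam lamP; rewrite !tsum_form_der // (e _ lamP) (e _ (form_der lamP j)) //.
Qed.

Lemma tder_mul j l l' :
  teq (tder j (tmul l l')) (tmul (tder j l) l' ++ tmul l (tder j l')).
Proof.
move=> lam [lA _]; rewrite tsum_cat !(tsum_der, tsum_mul) -tsum_add.
apply: eq_tsum => x y; rewrite tsum_der -!tsum_add; apply: eq_tsum => x' y'.
by rewrite /tpair !(derM.1 j).2 !lA !rmorphD; ring.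
Qed.

Lemma tderC j j' l : tsum (tder j (tder j' l)) =1 tsum (tder j' (tder j l)).
Proof.
move=> phi; rewrite !tsum_der; apply: eq_tsum => x y.
by rewrite (derM.2 j j' x) (derM.2 j j' y); ring.
Qed.

(** [f] and [g] are the two factors and [ev lam] is the contraction by [lam], through which elements
    of [A] are shown to be nonzero. *)
Lemma tensor_square (z : M) : ~ (exists c, z = i c) ->
  exists (A : comNzRingType) (D : I -> A -> A) (f g : {rmorphism M -> A})
    (ev : (M -> K) -> A -> M),
    [/\ forall j, ring_derivation (D j),
        forall j j' a, D j (D j' a) = D j' (D j a),
        forall j x, D j (f x) = f (dM j x) /\ D j (g x) = g (dM j x),
        forall c, f (i c) = g (i c) &
        forall lam, semilinear_form i lam ->
          {morph ev lam : a b / a + b} /\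
          (forall x y, ev lam (f x * g y) = i (lam x) * y)].
Proof.
move=> zK; have [lam0 [lam0P lam01 lam0z]] := separating_form zK.
have sumT l l' : tsum l =1 tsum l' -> teq l l' by move=> e lam _; rewrite e.
have [|||||||||||||||A [p [psurj pE p1 [padd pmul popp]]]] :=
    @quotient_comring _ teq [::] [:: (1, 1)] cat tmul topp.
- by [].
- by move=> x y e lam lamP; rewrite e.
- by move=> ? ? ? ; apply: teq_trans.
- by move=> x x' y y' e e' lam lamP; rewrite !tsum_cat e // e'.
- by move=> *; apply: tmul_comp.
- move=> x x' e lam lamP; rewrite !tsum_opp.
  have H l : tsum l (fun x => tpair lam (- x)) = -1 * tsum l (tpair lam).
    rewrite -tsum_mull; apply: eq_tsum => a b.
    by rewrite /tpair formN // rmorphN; ring.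
  by rewrite !H e.
- by move=> x y w; apply: sumT => ?; rewrite catA.
- by move=> x y; apply: sumT => ?; rewrite !tsum_cat addrC.
- by [].
- move=> x lam lamP; rewrite tsum_cat tsum_opp -tsum_add /tsum big_nil.
  by apply: big1 => q _; rewrite /tpair formN // rmorphN mulNr addNr.
- by move=> x y w; apply: sumT; apply: tmulA.
- exact: tmulC.
- move=> x; apply: sumT => phi; rewrite tsum_mul {1}/tsum big_seq1.
  by apply: eq_tsum => a b; rewrite !mul1r.
- by move=> x y w; apply: sumT; apply: tmulDl.
(* The ring is nonzero: contraction by the form x -> lam0(z x) sends 1 to lam0(z) = 1. *)
- move=> e; have := e _ (form_mul lam0P z); rewrite /tsum big_seq1 big_nil.
  by rewrite /tpair /= !mulr1 lam0z rmorph1 => /eqP; rewrite oner_eq0.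
have [r rK] := choice psurj.
have er l : teq (r (p l)) l by apply/pE; rewrite rK.
pose D j a := p (tder j (r a)).
have Dp j l : D j (p l) = p (tder j l) by apply/pE/tder_comp.
have psurj' (P : A -> Prop) : (forall l, P (p l)) -> forall a, P a.
  by move=> H a; rewrite -(rK a).
pose f0 x := p [:: (x, 1)]; pose g0 x := p [:: (1, x)].
have p0 : p [::] = 0.
  by apply: (addIr (p [::])); rewrite -padd add0r.
have fz : zmod_morphism f0.
  move=> x y; rewrite /f0 -popp -padd; apply/pE => lam lamP.
  by rewrite /tsum /= !big_cons !big_nil /tpair lamP.1 formN //= rmorphB; ring.
have gz : zmod_morphism g0.
  move=> x y; rewrite /g0 -popp -padd; apply/pE => lam lamP.
  by rewrite /tsum /= !big_cons !big_nil /tpair formN //= rmorphN; ring.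
have fm : monoid_morphism f0.
  by split=> // x y; rewrite /f0 -pmul /tmul /= mulr1.
have gm : monoid_morphism g0.
  by split=> // x y; rewrite /g0 -pmul /tmul /= mulr1.
pose fR := HB.pack_for {rmorphism M -> A} f0
  (GRing.isZmodMorphism.Build M A f0 fz) (GRing.isMonoidMorphism.Build M A f0 fm).
pose gR := HB.pack_for {rmorphism M -> A} g0
  (GRing.isZmodMorphism.Build M A g0 gz) (GRing.isMonoidMorphism.Build M A g0 gm).
have lam1 j : dM j 1 = 0 by apply: der1 (derM.1 j).
exists A, D, fR, gR, (fun lam a => tsum (r a) (tpair lam)); split.
- move=> j; split.
    do 2!elim/psurj' => ?; rewrite -padd !Dp -padd; apply/pE/sumT => phi.
    by rewrite !(tsum_cat, tsum_der).
  by do 2!elim/psurj' => ?; rewrite -pmul !Dp -!pmul -padd; apply/pE/tder_mul.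
- by move=> j j'; elim/psurj' => ?; rewrite !Dp; apply/pE/sumT/tderC.
- move=> j x /=; rewrite !Dp; split; apply/pE => lam lamP.
    by rewrite /tsum /= !big_cons !big_nil /tpair /= lam1; ring.
  by rewrite /tsum /= !big_cons !big_nil /tpair /= lam1 form0 // rmorph0; ring.
- move=> c /=; apply/pE => lam lamP; rewrite /tsum !big_seq1 /tpair /=.
  by rewrite -[i c in LHS]mulr1 lamP.2 rmorphM; ring.
- move=> lam lamP; split=> [a b|x y].
    by rewrite -tsum_cat; apply: (_ : teq _ _) => //; apply/pE; rewrite padd !rK.
  by rewrite /= -pmul er //= /tmul /tsum big_seq1 /tpair /= mulr1 mul1r.
Qed.

End TensorSquare.

Lemma horner_expansion (A : comNzRingType) (Q : {poly A}) (x s : A) :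
  exists r, Q.[x + s] = Q.[x] + s * (Q^`().[x] + s * r).
Proof.
elim/poly_ind: Q => [|Q c [r IH]].
  by exists 0; rewrite deriv0 !horner0; ring.
exists (Q^`().[x] + r * x + s * r).
rewrite derivMXaddC !hornerMXaddC IH hornerD hornerMX; ring.
Qed.

(** For an annihilating polynomial of least size, the derivative is nonzero in characteristic zero
    and smaller, so it cannot vanish at z. *)
Lemma separable_annihilator (K M : fieldType) (i : {rmorphism K -> M}) (z : M)
    (p : {poly K}) :
  [pchar K] =i pred0 -> p != 0 -> root (map_poly i p) z ->
  exists q : {poly K}, root (map_poly i q) z /\ (map_poly i q)^`().[z] != 0.
Proof.
move=> charK p0 pz.
pose P n := `[< exists q : {poly K}, [/\ q != 0, root (map_poly i q) z & size q = n] >].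
have exP : exists n, P n by exists (size p); apply/asboolP; exists p.
case: (ex_minnP exP) => n /asboolP[q [q0 qz <-]] qmin.
exists q; split=> //; apply/negP => q'z.
have /qmin : P (size q^`()).
  apply/asboolP; exists q^`(); split=> //; last by rewrite deriv_map in q'z.
  have q2 : (1 < size q)%N.
    rewrite ltnNge; apply/negP => /size1_polyC qC.
    move: qz q0; rewrite qC map_polyC rootC fmorph_eq0 => /eqP ->.
    by rewrite eqxx.
  apply/eqP => /(congr1 (fun r : {poly K} => r`_(size q).-2)).
  rewrite coef_deriv coef0 -mulr_natl => /eqP; rewrite mulf_eq0.
  move/pcharf0P: charK => ->; rewrite /= -subn2 -subSn // subSS subn1 -lead_coefE.
  by rewrite lead_coef_eq0 (negPf q0).
by rewrite leqNgt lt_size_deriv.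
Qed.

Lemma separating_embeddings (I : Type) (K M : fieldType) (i : {rmorphism K -> M})
    (dK : I -> K -> K) (dM : I -> M -> M) (z : M) :
  [pchar K] =i pred0 -> (forall j, derivation (dK j)) ->
  commuting_derivations dM -> diff_compatible dK dM i -> ~ (exists c, z = i c) ->
  exists (E : fieldType) (dE : I -> E -> E) (f g : {rmorphism M -> E}),
    [/\ commuting_derivations dE, diff_compatible dM dE f,
        diff_compatible dM dE g, forall c, f (i c) = g (i c) & f z <> g z].
Proof.
move=> charK derK derM compM zK.
have [A [D [f [g [ev [derD comD fgD fgK evP]]]]]] := tensor_square derK derM compM zK.
have [lam [lamP lam1 lamz]] := separating_form zK.
have [evD evM] := evP _ lamP.
have ev0 : ev lam 0 = 0 by apply: (addIr (ev lam 0)); rewrite -evD !add0r.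
pose s := f z - g z.
have evs : ev lam s = 1.
  have -> : s = f z * g 1 + f 1 * g (- z) by rewrite /s !rmorph1 rmorphN; ring.
  by rewrite evD !evM lam1 lamz rmorph0 rmorph1; ring.
have snil n : s ^+ n <> 0.
  move=> sn0.
  (* Contracting the binomial expansion of s^(n+1) = 0 by [lam] gives an equation for z. Its
     coefficient of degree n is, up to sign, (n+1) lam(z), hence nonzero. *)
  have [p p0 pz] : exists2 p : {poly K}, p != 0 & root (map_poly i p) z.
    case: n sn0 => [/eqP|n sn0]; first by rewrite expr0 oner_eq0.
    exists (\poly_(j < n.+2) ((-1) ^+ j * lam (z ^+ (n.+1 - j)) *+ 'C(n.+1, j))).
      apply/eqP => /(congr1 (fun r : {poly K} => r`_n)).
      rewrite coef_poly coef0 leqnSn subSnn expr1 lamz mulr1 binSn -mulr_natr => /eqP.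
      by rewrite mulf_eq0 signr_eq0; move/pcharf0P: charK => ->.
    have map_poly_poly m (e : nat -> K) :
        map_poly i (\poly_(j < m) e j) = \poly_(j < m) i (e j).
      apply/polyP => j; rewrite coef_map !coef_poly; case: ifP => //.
      by rewrite raddf0.
    rewrite /root map_poly_poly horner_poly; apply/eqP.
    transitivity (ev lam (s ^+ n.+1)); last by rewrite sn0 ev0.
    rewrite /s exprBn.
    rewrite (big_morph (ev lam) evD ev0). apply: eq_bigr => j _.
    have -> : (-1) ^+ j * f z ^+ (n.+1 - j) * g z ^+ j *+ 'C(n.+1, j) =
       f (z ^+ (n.+1 - j)) * g ((-1) ^+ j * z ^+ j *+ 'C(n.+1, j)).
      rewrite (rmorphXn f) (rmorphMn g) (rmorphM g) !(rmorphXn g) (rmorphN1 g).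
      by rewrite mulrnAr; congr (_ *+ _); rewrite mulrA; congr (_ * _); exact: mulrC.
    rewrite evM (rmorphMn i) (rmorphM i) (rmorphXn i) (rmorphN1 i).
    rewrite mulrnAl mulrnAr; congr (_ *+ _); rewrite mulrA; congr (_ * _); exact: mulrC.
  have [q [qz q'z]] := separable_annihilator charK p0 pz.
  pose Q := map_poly f (map_poly i q).
  have QE : Q = map_poly g (map_poly i q).
    by rewrite /Q -!map_poly_comp; apply: eq_map_poly => c /=.
  (* [Q] vanishes at [f z] and [g z], and its derivative at [g z] is a unit, so s is a multiple of
     s^2, hence of every power of s. Nilpotency would give s = 0, against [evs]. *)
  have [r] := horner_expansion Q (g z) s.
  have -> : g z + s = f z by rewrite /s; ring.
  have -> : Q.[f z] = 0 by rewrite horner_map (eqP qz) rmorph0.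
  rewrite {1}QE horner_map (eqP qz) rmorph0 add0r QE deriv_map horner_map.
  set u := _.[z] => E.
  have sE : s = s ^+ 2 * (- r * g u^-1).
    have gu : g u * g u^-1 = 1 by rewrite -rmorphM divff // rmorph1.
    rewrite -[LHS]mulr1 -gu; have -> : s * (g u * g u^-1) =
      s * (g u + s * r) * g u^-1 - s ^+ 2 * r * g u^-1 by ring.
    by rewrite -E mul0r sub0r; ring.
  have spow k : exists c, s = s ^+ k.+1 * c.
    elim: k => [|k [c IH]]; first by exists 1; rewrite mulr1.
    exists (c * (- r * g u^-1)); rewrite {1}IH exprS {1}sE !exprS; ring.
  have [c sc] := spow n; have : ev lam s = 0.
    by rewrite sc exprS sn0 mulr0 mul0r.
  by rewrite evs => /eqP; rewrite oner_eq0.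
have natA n : exists c : A, c * n.+1%:R = 1.
  exists (f n.+1%:R^-1); rewrite -(rmorph_nat f) -rmorphM mulVf ?rmorph1 //.
  by rewrite -(rmorph_nat i) fmorph_eq0; move/pcharf0P: charK => ->.
have [J [JI J0 Jav Jprime]] := prime_diff_ideal derD natA snil.
have [E [dE [h [derE hD hJ]]]] := fraction_dfield derD comD JI J0 (Jav 0%N) Jprime.
exists E, dE, (h \o f)%FUN, (h \o g)%FUN; split=> //=.
- by move=> j a /=; rewrite -hD (fgD j a).1.
- by move=> j a /=; rewrite -hD (fgD j a).2.
- by move=> c; rewrite /= fgK.
- move/eqP; rewrite -subr_eq0 -rmorphB => /eqP/hJ; rewrite -/s -(expr1 s).
  exact: Jav.
Qed.

(** * Specialization of constants *)

Fixpoint dsubst (F : fieldType) (I V W : Type) (s : V -> dpoly F I W)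
    (t : dpoly F I V) : dpoly F I W :=
  match t with
  | DVar v => s v
  | DConst c => DConst I W c
  | DAdd t1 t2 => DAdd (dsubst s t1) (dsubst s t2)
  | DMul t1 t2 => DMul (dsubst s t1) (dsubst s t2)
  | DDer i t1 => DDer i (dsubst s t1)
  end.

Lemma deval_subst (F : fieldType) (I V W : Type) (E : fieldType) (f : F -> E)
    (d : I -> E -> E) (y : W -> E) (s : V -> dpoly F I W) (t : dpoly F I V) :
  deval f d y (dsubst s t) = deval f d (fun v => deval f d y (s v)) t.
Proof. by elim: t => //= [? -> ? ->|? -> ? ->|? ? ->]. Qed.

Lemma eq_deval (F : fieldType) (I V : Type) (E : fieldType) (f f' : F -> E)
    (d : I -> E -> E) (y y' : V -> E) (t : dpoly F I V) :
  f =1 f' -> y =1 y' -> deval f d y t = deval f' d y' t.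
Proof. by move=> ef ey; elim: t => //= [? -> ? ->|? -> ? ->|? ? ->]. Qed.

Lemma rmorph_deval (F : fieldType) (I V : Type) (E E' : fieldType) (f : F -> E)
    (d : I -> E -> E) (d' : I -> E' -> E') (g : {rmorphism E -> E'})
    (y : V -> E) (t : dpoly F I V) :
  diff_compatible d d' g ->
  g (deval f d y t) = deval (g \o f) d' (g \o y) t.
Proof.
move=> gd; elim: t => //= [? IH1 ? IH2|? IH1 ? IH2|? ? IH].
- by rewrite rmorphD IH1 IH2.
- by rewrite rmorphM IH1 IH2.
- by rewrite gd IH.
Qed.

Lemma deval_const (F : fieldType) (I V : Type) (E : fieldType) (f : F -> E)
    (d : I -> E -> E) (D : E -> E) (y : V -> E) (t : dpoly F I V) :
  derivation D -> (forall i, derivation (d i)) ->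
  (forall i a, D (d i a) = d i (D a)) ->
  (forall c, D (f c) = 0) -> (forall v, D (y v) = 0) -> D (deval f d y t) = 0.
Proof.
move=> [DA DM] derd Dd Df Dy; elim: t => //= [? IH1 ? IH2|? IH1 ? IH2|i ? IH].
- by rewrite DA IH1 IH2 addr0.
- by rewrite DM IH1 IH2 mul0r mulr0 addr0.
- by rewrite Dd IH (der0 (derd i)).
Qed.

Lemma derN (E : fieldType) (D : E -> E) x : derivation D -> D (- x) = - D x.
Proof.
by move=> H; apply: (addIr (D x)); rewrite -H.1 !addNr der0.
Qed.

Lemma derB (E : fieldType) (D : E -> E) x y :
  derivation D -> D (x - y) = D x - D y.
Proof. by move=> H; rewrite H.1 derN. Qed.

Lemma derV (E : fieldType) (D : E -> E) x :
  derivation D -> x != 0 -> D x^-1 = - D x / x ^+ 2.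
Proof.
move=> H x0; have := H.2 x x^-1; rewrite divff // der1 // => /esym E1.
have -> : D x^-1 = (D x / x + x * D x^-1 - D x / x) / x by field.
by rewrite E1; field.
Qed.

(** * Linear disjointness from the constants *)

Section ConstantSpan.
Variables (M E : fieldType) (D : M -> M) (D' : E -> E) (f : {rmorphism M -> E}).
Hypotheses (derD : derivation D) (derD' : derivation D').
Hypothesis fD : forall x, f (D x) = D' (f x).

Fixpoint const_span (ms : seq M) (x : M) : Prop :=
  if ms is m :: ms' then exists c, D c = 0 /\ const_span ms' (x - c * m)
  else x = 0.

Lemma const_span_scale m ms x :
  const_span [seq n * m | n <- ms] x -> m != 0 -> const_span ms (x / m).
Proof.
move=> + m0; elim: ms x => [|n ms IH] x /=; first by move->; rewrite mul0r.
case=> c [Dc /IH]; rewrite (_ : (_ - _) / m = x / m - c * n); last by field.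
by exists c.
Qed.

(** Integration of a combination with constant coefficients; the integration constant becomes the
    coefficient of the generator that the Wronskian argument divides out. *)
Lemma const_span_der ms x : const_span [seq D n | n <- ms] (D x) ->
  exists2 c, D c = 0 & const_span ms (x - c).
Proof.
elim: ms x => [|n ms IH] x /=; first by exists x; rewrite ?subrr.
case=> c [Dc]; rewrite (_ : _ - _ = D (x - c * n)); last first.
  by rewrite derB // derD.2 Dc mul0r add0r.
case/IH => a Da; rewrite addrAC => ?; exists a => //.
by exists c.
Qed.

(* The Wronskian argument: dividing by [f m_1] and deriving removes the first
   term of the relation. *)
Lemma const_spanP (l : seq (M * E)) (x : M) :
  all (fun p => D' p.2 == 0) l -> f x = \sum_(p <- l) f p.1 * p.2 ->
  const_span (unzip1 l) x.
Proof.
elim: {l}(size l) {-2}l (erefl (size l)) x => [|n IH] [|[m c] l] //= sz x cl.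
  by rewrite big_nil => /eqP; rewrite fmorph_eq0 => /eqP.
move: cl => /andP[/eqP D'c cl']; case: sz => sz; rewrite big_cons /= => E1.
have [m0|m0] := eqVneq m 0.
  exists 0; rewrite der0 // mul0r subr0; split=> //; apply: IH => //.
  by rewrite E1 m0 rmorph0 mul0r add0r.
pose l' := [seq (D (p.1 / m), p.2) | p <- l].
have : const_span (unzip1 l') (D (x / m)).
  apply: IH; rewrite ?size_map ?all_map //.
  have -> : f (D (x / m)) = D' (c + \sum_(p <- l) f (p.1 / m) * p.2).
    rewrite fD; congr D'; rewrite rmorphM E1 mulrDl fmorphV mulrAC divff ?mul1r ?fmorph_eq0 //.
    congr (_ + _); rewrite big_distrl; apply: eq_bigr => p _.
    by rewrite rmorphM fmorphV mulrAC.
  rewrite derD'.1 D'c add0r big_map.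
  have D'0 : D' 0 = 0 := der0 derD'.
  rewrite (big_morph D' derD'.1 D'0).
  elim: (l) cl' => [|p l1 IHl] /=; first by rewrite !big_nil.
  case/andP=> /eqP Dp /IHl e1; rewrite !big_cons /= e1 derD'.2 Dp.
  by rewrite mulr0 addr0 fD.
rewrite (_ : unzip1 l' = map D [seq n * m^-1 | n <- unzip1 l]); last first.
  by rewrite /unzip1 -!map_comp.
case/const_span_der => c' Dc' /const_span_scale; rewrite invr_neq0 // invrK.
move/(_ isT) => H; exists c'; split=> //.
by rewrite (_ : x - c' * m = (x / m - c') * m) //; field.
Qed.

End ConstantSpan.

(** * Specializing relations with coefficients in the extension *)

Section Specialization.
Variables (m : nat) (F M E : fieldType) (V : Type).
Variables (dF : 'I_m -> F -> F) (dM : option 'I_m -> M -> M).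
Variables (dE : option 'I_m -> E -> E).
Variables (kap : {rmorphism F -> M}) (f : {rmorphism M -> E}).
Hypotheses (derM : commuting_derivations dM) (derE : commuting_derivations dE).
Hypothesis fd : diff_compatible dM dE f.
Hypothesis kapd : forall i a, dM (Some i) (kap a) = kap (dF i a).
Hypothesis constM : forall x, dM None x = 0 <-> exists a, x = kap a.
Variables (y : V -> E) (y0 : V -> F).
Hypothesis consty : forall v, dE None (y v) = 0.

Let valE (t : dpoly F 'I_m V) := deval (f \o kap) (fun i => dE (Some i)) y t.
Let valF (t : dpoly F 'I_m V) := deval id dF y0 t.
Hypothesis spec : forall t, valE t = 0 -> valF t = 0.

Lemma valE_const t : dE None (valE t) = 0.
Proof.
apply: deval_const => //= [|i|i a|c].
- exact: derE.1.
- exact: derE.1.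
- exact: derE.2.
- by rewrite -fd (_ : dM None _ = 0) ?rmorph0 //; apply/constM; exists c.
Qed.

Lemma const_span_merge (l : seq (M * dpoly F 'I_m V)) x t :
  const_span (dM None) (unzip1 l) x ->
  exists l', [/\ size l' = size l,
    \sum_(p <- l') f p.1 * valE p.2 =
      f x * valE t + \sum_(p <- l) f p.1 * valE p.2 &
    \sum_(p <- l') p.1 * kap (valF p.2) =
      x * kap (valF t) + \sum_(p <- l) p.1 * kap (valF p.2)].
Proof.
elim: l x => [|[n s] l IH] x /=.
  by move->; exists [::]; rewrite !big_nil rmorph0 !mul0r !addr0.
case=> c [/constM[a ->] /IH [l' [sz e1 e2]]].
exists ((n, DAdd (DMul (DConst _ _ a) t) s) :: l'); rewrite !big_cons /= sz.
have -> : valE (DAdd (DMul (DConst _ _ a) t) s) = f (kap a) * valE t + valE s by [].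
have -> : valF (DAdd (DMul (DConst _ _ a) t) s) = a * valF t + valF s by [].
rewrite e1 e2 (rmorphB f) (rmorphD kap) (rmorphM kap) (rmorphM f).
by split=> //; ring.
Qed.

(** Constants of [M] come from [F], so a coefficient in the constant span of the others is absorbed
    into the differential polynomials and the relation shortens. Otherwise linear disjointness
    forces its partner to vanish, and [spec] transfers this zero. *)
Lemma specialization_relation (l : seq (M * dpoly F 'I_m V)) :
  \sum_(p <- l) f p.1 * valE p.2 = 0 -> \sum_(p <- l) p.1 * kap (valF p.2) = 0.
Proof.
elim: {l}(size l) {-2}l (erefl (size l)) => [|n IH] [|[x t] l] //=.
  by rewrite !big_nil.
case=> sz; rewrite !big_cons /= => E0.
have [/(const_span_merge t) [l' [sz' e1 e2]]|nsp] :=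
    pselect (const_span (dM None) (unzip1 l) x).
  by rewrite -e2; apply: IH; [rewrite sz' | rewrite e1].
have t0 : valE t = 0.
  apply: contrapT => /eqP t0; apply: nsp.
  pose l' := [seq (p.1, - valE p.2 / valE t) | p <- l].
  have -> : unzip1 l = unzip1 l' by rewrite /unzip1 -!map_comp.
  apply: (@const_spanP M E (dM None) (dE None) f).
  - exact: derM.1.
  - exact: derE.1.
  - by move=> z; rewrite fd.
  - rewrite all_map; apply/allT => p /=; apply/eqP.
    rewrite (derE.1 None).2 (derV (derE.1 None) t0) (derN _ (derE.1 None)).
    by rewrite !valE_const oppr0 !mul0r mulr0 addr0.
  - rewrite big_map /=; apply: (mulIf t0); rewrite big_distrl /=.
    move/eqP: E0; rewrite addr_eq0 => /eqP ->; rewrite -sumrN.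
    by apply: eq_bigr => p _; field.
rewrite (spec t0) rmorph0 mulr0 add0r; apply: IH => //.
by move: E0; rewrite t0 mulr0 add0r.
Qed.

(** Graph of the specialization that sends f(x) to x and [y] to [y0]. Being a relation, it involves
    no choice of representation; [specializes0] says that it is well defined. *)
Definition specializes (e : E) (x : M) : Prop :=
  exists l : seq (M * dpoly F 'I_m V),
    e = \sum_(p <- l) f p.1 * valE p.2 /\ x = \sum_(p <- l) p.1 * kap (valF p.2).

Lemma specializes0 x : specializes 0 x -> x = 0.
Proof. by case=> l [/esym E0 ->]; apply: specialization_relation. Qed.

Lemma specializes1 x (t : dpoly F 'I_m V) :
  specializes (f x * valE t) (x * kap (valF t)).
Proof. by exists [:: (x, t)]; rewrite !big_seq1. Qed.

Lemma specializesD e e' x x' :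
  specializes e x -> specializes e' x' -> specializes (e + e') (x + x').
Proof.
move=> [l [-> ->]] [l' [-> ->]]; exists (l ++ l').
by rewrite !big_cat.
Qed.

Lemma specializesM e e' x x' :
  specializes e x -> specializes e' x' -> specializes (e * e') (x * x').
Proof.
move=> [l [-> ->]] [l' [-> ->]].
exists [seq (p.1 * q.1, DMul p.2 q.2) | p <- l, q <- l'].
rewrite !big_allpairs_dep /= !big_distrl /=; split; apply: eq_bigr => p _;
  rewrite big_distrr; apply: eq_bigr => q _ /=.
  by rewrite rmorphM /valE /=; ring.
by rewrite /valF /= rmorphM; ring.
Qed.

Lemma specializes_der o e x : specializes e x -> specializes (dE o e) (dM o x).
Proof.
have dM0 : dM o 0 = 0 := der0 (derM.1 o).
have dE0 : dE o 0 = 0 := der0 (derE.1 o).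
move=> [l [-> ->]]; rewrite (big_morph _ (derM.1 o).1 dM0).
rewrite (big_morph _ (derE.1 o).1 dE0).
elim: l => [|[n t] l IH]; first by rewrite !big_nil; exists [::]; rewrite !big_nil.
rewrite !big_cons /=; apply: specializesD => //.
rewrite (derM.1 o).2 (derE.1 o).2 -fd; apply: specializesD.
  exact: specializes1.
case: o {dM0 dE0 IH} => [i|].
  by rewrite kapd; apply: (specializes1 n (DDer i t)).
rewrite valE_const mulr0 (_ : dM None _ = 0) ?mulr0; last first.
  by apply/constM; exists (valF t).
by exists [::]; rewrite !big_nil.
Qed.

Lemma specializes_deval (K : fieldType) (W : Type) (iM : K -> M)
    (w : W -> E) (w0 : W -> M) (P : dpoly K (option 'I_m) W) :
  (forall v, specializes (w v) (w0 v)) ->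
  specializes (deval (f \o iM) dE w P) (deval iM dM w0 P).
Proof.
move=> ww0; elim: P => /= [//|c|? IH1 ? IH2|? IH1 ? IH2|o ? IH].
- have := specializes1 (iM c) (DConst _ _ 1).
  by rewrite /valE /valF /= !rmorph1 !mulr1.
- exact: specializesD.
- exact: specializesM.
- exact: specializes_der.
Qed.

End Specialization.

(** * Differential automorphisms from equality of relations *)

Section DifferentialAutomorphism.
Variables (I V : Type) (K M : fieldType).
Variables (iM : {rmorphism K -> M}) (dM : I -> M -> M).
Hypothesis derM : forall i, derivation (dM i).

Definition dsub (P Q : dpoly K I V) := DAdd P (DMul (DConst _ _ (-1)) Q).

Lemma deval_sub y P Q :
  deval iM dM y (dsub P Q) = deval iM dM y P - deval iM dM y Q.
Proof. by rewrite /= rmorphN1 mulN1r. Qed.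

Lemma dgenerated_fraction (y : V -> M) z : dgenerated iM dM y z ->
  exists P Q : dpoly K I V,
    deval iM dM y Q != 0 /\ z * deval iM dM y Q = deval iM dM y P.
Proof.
move=> /(_ (fun z => exists P Q : dpoly K I V,
  deval iM dM y Q != 0 /\ z * deval iM dM y Q = deval iM dM y P)).
apply; last first.
- by move=> v; exists (DVar _ _ v), (DConst _ _ 1); rewrite /= rmorph1 mulr1 oner_eq0.
- by move=> c; exists (DConst _ _ c), (DConst _ _ 1); rewrite /= rmorph1 mulr1 oner_eq0.
split.
- by exists (DConst _ _ 1), (DConst _ _ 1); rewrite /= rmorph1 mulr1 oner_eq0.
- move=> a b [P [Q [Q0 aE]]] [P' [Q' [Q'0 bE]]].
  exists (dsub (DMul P Q') (DMul P' Q)), (DMul Q Q').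
  by rewrite deval_sub /= mulf_neq0 // -aE -bE; split=> //; ring.
- move=> a b [P [Q [Q0 aE]]] [P' [Q' [Q'0 bE]]].
  have [b0|b0] := eqVneq b 0.
    by exists (DConst _ _ 0), Q; rewrite /= b0 invr0 mulr0 mul0r rmorph0.
  exists (DMul P Q'), (DMul P' Q); rewrite /= -aE -bE !mulf_neq0 //.
  by split=> //; field.
- move=> i a [P [Q [Q0 aE]]].
  exists (dsub (DMul (DDer i P) Q) (DMul P (DDer i Q))).
  exists (DMul Q Q); rewrite deval_sub /= mulf_neq0 // -aE (derM i).2.
  by split=> //; ring.
Qed.

Lemma dsubfieldP (P : M -> Prop) : dsubfield dM P ->
  [/\ forall a b, P a -> P b -> P (a + b), forall a b, P a -> P b -> P (a * b),
      P 0, P 1 & forall a, P a -> P a^-1].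
Proof.
case=> P1 PB PV PD; have P0 : P 0 by rewrite -(subrr 1); apply: PB.
have PVi a : P a -> P a^-1 by rewrite -[a^-1]mul1r; apply: PV.
split=> // a b Pa Pb; first by rewrite -[b]opprK -[- b]sub0r; apply/PB/PB.
by rewrite -[b]invrK; apply/PV/PVi.
Qed.

(** An element P(y)/Q(y) is sent to P(w)/Q(w); equality of relations makes this well defined and
    keeps denominators nonzero. The image contains [w], hence by [genw] also [y]. *)
Lemma differential_automorphism (y w : V -> M) :
  (forall P : dpoly K I V, deval iM dM y P = 0 <-> deval iM dM w P = 0) ->
  (forall z, dgenerated iM dM y z) -> (forall v, dgenerated iM dM w (y v)) ->
  exists s : {rmorphism M -> M},
    [/\ bijective s, diff_compatible dM dM s, forall c, s (iM c) = iM c &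
        forall v, s (y v) = w v].
Proof.
move=> yw geny genw.
pose Y := deval iM dM y; pose W := deval iM dM w.
have W0 Q : Y Q != 0 -> W Q != 0 by apply: contra_neq => /yw.
have frac z : {PQ : dpoly K I V * dpoly K I V | Y PQ.2 != 0 /\ z * Y PQ.2 = Y PQ.1}.
  by apply: cid; have [P [Q ?]] := dgenerated_fraction (geny z); exists (P, Q).
pose s0 z := W (sval (frac z)).1 / W (sval (frac z)).2.
have sE z P Q : Y Q != 0 -> z * Y Q = Y P -> s0 z * W Q = W P.
  rewrite /s0; case: (frac z) => -[P' Q'] /= [Q'0 zE'] Q0 zE.
  have := yw (dsub (DMul P Q') (DMul P' Q)).
  rewrite !deval_sub => -[E1 _].
  have {E1} : W P * W Q' - W P' * W Q = 0.
    by apply: E1; rewrite /= -/(Y P) -/(Y Q') -/(Y P') -/(Y Q) -zE -zE'; ring.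
  move/eqP; rewrite subr_eq0 => /eqP E1.
  have WQ' := W0 _ Q'0.
  by apply: (mulIf WQ'); rewrite mulrAC divfK // E1.
have sW P : s0 (Y P) = W P.
  have := @sE (Y P) P (DConst _ _ 1); rewrite /Y /W /= rmorph1 !mulr1.
  by apply=> //; exact: oner_neq0.
have frac2 z z' : exists P P' Q,
    [/\ Y Q != 0, z * Y Q = Y P & z' * Y Q = Y P'].
  have [P [Q [Q0 zE]]] := dgenerated_fraction (geny z).
  have [P' [Q' [Q'0 zE']]] := dgenerated_fraction (geny z').
  exists (DMul P Q'), (DMul P' Q), (DMul Q Q'); rewrite /Y /= -zE -zE' mulf_neq0 //.
  by split=> //; ring.
have sz : zmod_morphism s0.
  move=> z z'; have [P [P' [Q [Q0 zE zE']]]] := frac2 z z'.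
  apply: (mulIf (W0 _ Q0)).
  rewrite (sE _ (dsub P P') Q) //.
    by rewrite [LHS]deval_sub -/(W P) -/(W P') -(sE _ _ _ Q0 zE) -(sE _ _ _ Q0 zE'); ring.
  by rewrite [RHS]deval_sub -/(Y P) -/(Y P') -zE -zE'; ring.
have sm : monoid_morphism s0.
  split=> [|z z'].
    by have := sW (DConst _ _ 1); rewrite /Y /W /= rmorph1.
  have [P [P' [Q [Q0 zE zE']]]] := frac2 z z'.
  have QQ0 : W (DMul Q Q) != 0 by rewrite mulf_neq0 ?W0.
  apply: (mulIf QQ0).
  rewrite (sE _ (DMul P P') (DMul Q Q)).
  - by rewrite /W /= -/(W P) -/(W P') -/(W Q) -(sE _ _ _ Q0 zE) -(sE _ _ _ Q0 zE'); ring.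
  - by rewrite mulf_neq0.
  - by rewrite /Y /= -/(Y Q) -/(Y P) -/(Y P') -zE -zE'; ring.
pose sR := HB.pack_for {rmorphism M -> M} s0
  (GRing.isZmodMorphism.Build M M s0 sz) (GRing.isMonoidMorphism.Build M M s0 sm).
have [s ss0] : exists s : {rmorphism M -> M}, s =1 s0 by exists sR.
have sY P : s (Y P) = W P by rewrite ss0.
have sc c : s (iM c) = iM c by have := sY (DConst _ _ c).
have sy v : s (y v) = w v by have := sY (DVar _ _ v).
have sd : diff_compatible dM dM s.
  move=> i z; have [P [Q [Q0 zE]]] := dgenerated_fraction (geny z).
  apply: (mulIf (W0 _ Q0)); apply: (addIr (s z * W (DDer i Q))).
  have WP : W P = s z * W Q by rewrite -!sY -rmorphM zE.
  have <- : W (DDer i P) = dM i (s z) * W Q + s z * W (DDer i Q).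
    by rewrite -(derM i).2 -WP.
  rewrite -!sY -!rmorphM -rmorphD; congr (s _).
  by rewrite [RHS]/Y /= -zE (derM i).2.
have surj z : exists x, s x = z.
  have im_sub : dsubfield dM (fun z => exists x, s x = z).
    split=> [|a b [x <-] [x' <-]|a b [x <-] [x' <-]|i a [x <-]].
    - by exists 1; rewrite rmorph1.
    - by exists (x - x'); rewrite rmorphB.
    - by exists (x / x'); rewrite fmorph_div.
    - by exists (dM i x).
  apply: (geny z _ im_sub) => [c|v]; first by exists (iM c).
  by apply: (genw v _ im_sub) => [c|v']; [exists (iM c) | exists (y v')].
have [t tK] := choice surj.
by exists s; split=> //; exists t => // x; apply: (fmorph_inj s); rewrite tK.
Qed.

End DifferentialAutomorphism.

(** * Points of the Galois group *)

Lemma ord2_ind (P : 'I_2 -> Prop) : P 0 -> P 1 -> forall v, P v.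
Proof.
move=> P0 P1; case=> [[|[|//]]] lt_v.
  by rewrite (_ : Ordinal _ = 0) //; apply: val_inj.
by rewrite (_ : Ordinal _ = 1) //; apply: val_inj.
Qed.

Lemma tri_mxE (F : fieldType) (a b : F) :
  [/\ tri_mx a b 0 0 = a, tri_mx a b 0 1 = b, tri_mx a b 1 0 = 0 &
      tri_mx a b 1 1 = a^-1].
Proof.
have e0 : (0 : 'I_2) = lshift 1 (0 : 'I_1) by apply: val_inj.
have e1 : (1 : 'I_2) = rshift 1 (0 : 'I_1) by apply: val_inj.
split; rewrite ?e1 ?e0.
- by apply: (etrans (@block_mxEul _ 1 1 1 1 _ _ _ _ 0 0)); rewrite mxE.
- by apply: (etrans (@block_mxEur _ 1 1 1 1 _ _ _ _ 0 0)); rewrite mxE.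
- by apply: (etrans (@block_mxEdl _ 1 1 1 1 _ _ _ _ 0 0)); rewrite mxE.
- by apply: (etrans (@block_mxEdr _ 1 1 1 1 _ _ _ _ 0 0)); rewrite mxE.
Qed.

Lemma tri_mx_inj (F : fieldType) (a b a' b' : F) :
  tri_mx a b = tri_mx a' b' -> a = a' /\ b = b'.
Proof.
have [a0 b0 _ _] := tri_mxE a b; have [a1 b1 _ _] := tri_mxE a' b'.
by move=> e; split; [rewrite -a0 e a1 | rewrite -b0 e b1].
Qed.

Section Triangular.
Variables (m : nat) (F : fieldType) (M : fieldType).
Variables (dM : option 'I_m -> M -> M) (iM : {rmorphism ratfield F -> M}).
Variables (eta xi : M).

Lemma gal_tri_mx (a b : F) :
  gal_matrices iM dM (pair2 eta xi) (tri_mx a b) <->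
  exists s : {rmorphism M -> M},
    [/\ bijective s, diff_compatible dM dM s, forall f, s (iM f) = iM f &
        s eta = iM (ratC a) * eta /\
        s xi = iM (ratC b) * eta + iM (ratC a^-1) * xi].
Proof.
have [t00 t01 t10 t11] := tri_mxE a b.
have tofrac0 : iM (ratC 0) = 0 by rewrite /ratC !rmorph0.
split=> -[s [sbij sd sK sy]]; exists s; split=> //.
  have := sy 0; have := sy 1; rewrite !big_ord_recl !big_ord0 /=.
  rewrite (_ : lift ord0 ord0 = 1) ?t00 ?t01 ?t10 ?t11; last exact: val_inj.
  by rewrite tofrac0 mul0r !addr0.
apply: ord2_ind; rewrite !big_ord_recl !big_ord0 /=;
  rewrite (_ : lift ord0 ord0 = 1) ?t00 ?t01 ?t10 ?t11; try exact: val_inj.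
  by rewrite tofrac0 mul0r !addr0; case: sy.
by rewrite addr0; case: sy.
Qed.

End Triangular.

Section GaloisPoint.
Variables (m : nat) (F : fieldType) (dF : 'I_m -> F -> F).
Hypothesis closedF : diff_closed dF.
Variable dK : option 'I_m -> ratfield F -> ratfield F.
Hypothesis derK : is_ratfield_der dF dK.
Variables (q : ratfield F) (M : fieldType) (dM : option 'I_m -> M -> M).
Variable iM : {rmorphism ratfield F -> M}.
Hypothesis ppvM : is_PPV dK iM dM (coefs2 q).
Variables eta xi : M.
Hypothesis basisM : solution_basis iM dM (coefs2 q) (pair2 eta xi).
Variable u : ratfield F.
Hypothesis etaE : dM None eta = iM u * eta.
Hypothesis xi_eta : dM None (xi / eta) = eta ^- 2.

Definition base_const : {rmorphism F -> M} := iM \o (@tofrac _ \o polyC).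

Lemma dM_base_const i a : dM (Some i) (base_const a) = base_const (dF i a).
Proof.
case: ppvM => _ comp _ _; case: derK => _ dKC _ _ _.
by rewrite /= -[X in iM X]/(ratC a) -comp dKC.
Qed.

Lemma constMP x : dM None x = 0 <-> exists a, x = base_const a.
Proof.
case: ppvM => _ _ _ constM; case: derK => _ _ _ _ constK.
split=> [/constM[c [/constK[a ->] ->]]|[a ->]]; first by exists a.
by apply/constM; exists (ratC a); split=> //; apply/constK; exists a.
Qed.

Lemma eta_neq0 : eta != 0.
Proof.
case: basisM => _ indep _; apply/eqP => eta0.
have := indep (fun i => (i == 0)%:R).
rewrite !big_ord_recl big_ord0 /= eta0 mulr0 add0r.
have -> : iM (ratC 0) = 0 by rewrite /ratC !rmorph0.
by rewrite mul0r addr0 => /(_ erefl 0) /eqP; rewrite oner_eq0.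
Qed.

Lemma dgenerated_basis z : dgenerated iM dM (pair2 eta xi) z.
Proof.
case: ppvM => _ _ [y [ysol _ geny]] _; case: basisM => _ _ span.
move=> P subP PK Peta; apply: (geny z P subP PK) => i.
have [PD PM P0 _ _] := dsubfieldP subP.
have [c ->] := span _ (ysol i).
by apply: big_ind => // j _; apply: PM.
Qed.

Section Embeddings.
Variables (E : fieldType) (dE : option 'I_m -> E -> E).
Variables f g : {rmorphism M -> E}.
Hypothesis derE : commuting_derivations dE.
Hypotheses (fd : diff_compatible dM dE f) (gd : diff_compatible dM dE g).
Hypothesis fgK : forall c, f (iM c) = g (iM c).

Let a := g eta / f eta.
Let b := (g xi - a^-1 * f xi) / f eta.
Let valE (V : Type) (y : V -> E) (t : dpoly F 'I_m V) :=
  deval (f \o base_const) (fun i => dE (Some i)) y t.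

Lemma f_eta_neq0 : f eta != 0. Proof. by rewrite fmorph_eq0 eta_neq0. Qed.
Lemma g_eta_neq0 : g eta != 0. Proof. by rewrite fmorph_eq0 eta_neq0. Qed.
Lemma eta_ratio_neq0 : a != 0.
Proof. by rewrite mulf_neq0 ?invr_eq0 ?f_eta_neq0 ?g_eta_neq0. Qed.

Lemma embedding_etaE : g eta = f eta * a.
Proof. by rewrite mulrC divfK // f_eta_neq0. Qed.

Lemma embedding_xiE : g xi = f xi * a^-1 + f eta * b.
Proof. by rewrite [f eta * b]mulrC divfK ?f_eta_neq0 //; ring. Qed.

Lemma eta_ratio_const : dE None a = 0.
Proof.
apply: (mulIf f_eta_neq0); rewrite mul0r.
have : dE None (g eta) = dE None (f eta * a) by rewrite embedding_etaE.
rewrite (derE.1 None).2 -fd -gd etaE !rmorphM -fgK embedding_etaE => /eqP.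
by rewrite -subr_eq0 => /eqP E0; apply/eqP; rewrite -oppr_eq0 -E0; apply/eqP; ring.
Qed.

Lemma xi_shift_const : dE None b = 0.
Proof.
(* In terms of xi/eta, whose derivative is eta^-2, the two contributions a g(eta)^-2 and a^-1
   f(eta)^-2 are equal. *)
have bE : b = a * g (xi / eta) - a^-1 * f (xi / eta).
  rewrite /b !fmorph_div embedding_etaE; field.
  by rewrite f_eta_neq0 eta_ratio_neq0.
have D := derE.1 None.
rewrite bE (derB _ _ D) (D.2 a) (D.2 a^-1) eta_ratio_const (derV D eta_ratio_neq0) eta_ratio_const -fd -gd xi_eta.
rewrite !fmorphV !rmorphXn /= embedding_etaE; field.
by rewrite f_eta_neq0 eta_ratio_neq0 g_eta_neq0.
Qed.

(** Specializing (a, b) carries relations of (eta, xi) to the pair transformed by (a0, b0). The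
    converse is obtained from the inverse matrix, with the roles of [f] and [g] exchanged. *)
Lemma galois_point (t : dpoly F 'I_m 'I_2) : valE (pair2 a b) t != 0 ->
  exists a0 b0, gal_matrices iM dM (pair2 eta xi) (tri_mx a0 b0) /\
    deval id dF (pair2 a0 b0) t != 0.
Proof.
move=> t0.
pose y3 (R : fieldType) (x y z : R) (v : 'I_3) := nth 0 [:: x; y; z] v.
pose w2 (v : 'I_2) : 'I_3 := widen_ord (leqnSn 2) v.
have y3w2 (R : fieldType) (x y z : R) v : y3 R x y z (w2 v) = pair2 x y v.
  by move: v; apply: ord2_ind.
pose t3 := dsubst (fun v => DVar F 'I_m (w2 v)) t.
(* Rabinowitsch trick: [e] inverts a t(a, b), which keeps both [a0] and t(a0, b0) nonzero. *)
pose e := (a * valE (pair2 a b) t)^-1; pose y := y3 E a b e.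
have t3E : valE y t3 = valE (pair2 a b) t.
  by rewrite /valE deval_subst; apply: eq_deval => // v; exact: y3w2.
(* The system consists of all relations of (a, b, e) over [F], which is exactly what specialization
   asks of [y0]. *)
have [y0 y0P] : exists y0 : 'I_3 -> F,
    forall t, valE y t = 0 -> deval id dF y0 t = 0.
  have [|y0 y0P] := closedF (n := 3) (S := fun t => valE y t = 0); last by exists y0.
  exists E, (fun i => dE (Some i)), (f \o base_const); split.
  - by split=> [i|i j]; [exact: derE.1 | exact: derE.2].
  - by move=> i c; rewrite /= -[iM _]/(base_const _) -dM_base_const fd.
  - by exists y.
pose v0 : 'I_3 := inord 0; pose v1 : 'I_3 := inord 1; pose v2 : 'I_3 := inord 2.
have yE : [/\ y v0 = a, y v1 = b & y v2 = e] by rewrite /y /y3 !inordK.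
case: yE => yv0 yv1 yv2.
pose a0 := y0 v0; pose b0 := y0 v1.
(* a^-1 = e t(a, b) is thus a differential polynomial in the unknowns and can be specialized. *)
pose ainv := DMul (DVar F 'I_m v2) t3.
have ainvE : valE y ainv = a^-1.
  rewrite /valE /= -/(valE y t3) t3E yv2 /e invfM mulfVK //.
have t3F : deval id dF y0 t3 = deval id dF (pair2 a0 b0) t.
  rewrite deval_subst; apply: eq_deval => //; apply: ord2_ind => /=.
    by congr y0; apply: val_inj; rewrite /= inordK.
  by congr y0; apply: val_inj; rewrite /= inordK.
have ainvF : deval id dF y0 ainv * a0 = 1.
  have := y0P (DAdd (DMul ainv (DVar _ _ v0)) (DConst _ _ (-1))).
  rewrite /valE /= -/(valE y t3) t3E yv0 yv2 => H.
  apply/eqP; rewrite -subr_eq0; apply/eqP; apply: H.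
  rewrite !rmorphN1 /e invfM mulfVK // mulVf ?subrr //; exact: eta_ratio_neq0.
have a00 : a0 != 0 by apply: contra_eq_neq ainvF => ->; rewrite mulr0 eq_sym oner_eq0.
have ainv0 : deval id dF y0 ainv = a0^-1.
  by apply: (mulIf a00); rewrite ainvF mulVf.
exists a0, b0; split; last first.
  apply: contra_eq_neq ainvF => t00.
  by rewrite /= t3F t00 mulr0 mul0r eq_sym oner_eq0.
have derM : commuting_derivations dM by case: ppvM.
have const_y v : dE None (y v) = 0.
  have D := derE.1 None; rewrite /y /y3; case: v => [[|[|[|//]]] ?] /=.
  - exact: eta_ratio_const.
  - exact: xi_shift_const.
  - have tc : dE None (valE (pair2 a b) t) = 0.
      apply: deval_const => //= [i|i c|c|].
      + exact: derE.1.
      + exact: derE.2.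
      + rewrite -fd (_ : dM None _ = 0) ?rmorph0 //; apply/constMP; by exists c.
      + by apply: ord2_ind; [exact: eta_ratio_const | exact: xi_shift_const].
    have at0 : a * valE (pair2 a b) t != 0 by rewrite mulf_neq0 // eta_ratio_neq0.
    rewrite /e (derV D at0) (D.2 a (valE (pair2 a b) t)) tc eta_ratio_const.
    by rewrite mul0r mulr0 addr0 oppr0 mul0r.
have gE : g \o base_const =1 f \o base_const by move=> c /=; rewrite fgK.
pose spf := @specializes m F M E 'I_3 dF dE base_const f y y0.
pose spg := @specializes m F M E 'I_3 dF dE base_const g y y0.
have spf1 (x : M) s : spf (f x * valE y s) (x * base_const (deval id dF y0 s)).
  exact: specializes1.
have spg1 (x : M) s : spg (g x * valE y s) (x * base_const (deval id dF y0 s)).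
  by rewrite /valE -(eq_deval (fun i => dE (Some i)) s gE (frefl y)); exact: specializes1.
pose ya := pair2 (eta * base_const a0) (xi * base_const a0^-1 + eta * base_const b0).
(* The inverse matrix: f(eta) = g(eta) a^-1 and f(xi) = g(xi) a - g(eta) b. *)
pose yb := pair2 (eta * base_const a0^-1) (xi * base_const a0 + eta * base_const (- b0)).
have spa v : spf (g (pair2 eta xi v)) (ya v).
  move: v; apply: ord2_ind => /=.
    rewrite /ya /pair2 /= !(tnth_nth 0) /= embedding_etaE -yv0; exact: (spf1 eta (DVar _ _ v0)).
  rewrite /ya /pair2 /= !(tnth_nth 0) /= embedding_xiE -ainvE -ainv0 -[b]yv1; apply: specializesD.
    exact: spf1.
  exact: (spf1 eta (DVar _ _ v1)).
have spb v : spg (f (pair2 eta xi v)) (yb v).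
  have fE : f eta = g eta * a^-1 by rewrite embedding_etaE mulfK // eta_ratio_neq0.
  move: v; apply: ord2_ind => /=.
    by rewrite /yb /pair2 /= !(tnth_nth 0) /= fE -ainvE -ainv0; exact: spg1.
  have -> : f (pair2 eta xi 1) = g xi * a + g eta * - b.
    rewrite /pair2 (tnth_nth 0) /= embedding_xiE fE; field; exact: eta_ratio_neq0.
  rewrite /yb /pair2 /= !(tnth_nth 0) /= -[a]yv0 -[b]yv1; apply: specializesD.
    exact: (spg1 xi (DVar _ _ v0)).
  have := spg1 eta (DMul (DConst _ _ (-1)) (DVar _ _ v1)).
  by rewrite /valE /= !rmorphN1 !mulN1r.
have imp_a P : deval iM dM (pair2 eta xi) P = 0 -> deval iM dM ya P = 0.
  move=> P0; have := specializes_deval derM derE fd dM_base_const constMP const_y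
    iM P spa.
  have := rmorph_deval iM (pair2 eta xi) P gd; rewrite P0 rmorph0.
  have -> : deval (g \o iM) dE (g \o pair2 eta xi) P =
            deval (f \o iM) dE (g \o pair2 eta xi) P.
    by apply: eq_deval => // c /=; rewrite fgK.
  by move=> <-; exact: (specializes0 derM derE fd constMP const_y y0P).
have y0Pg s : deval (g \o base_const) (fun i => dE (Some i)) y s = 0 ->
    deval id dF y0 s = 0.
  by move=> s0; apply: y0P; rewrite -s0; apply: eq_deval => // c; rewrite gE.
have imp_b P : deval iM dM (pair2 eta xi) P = 0 -> deval iM dM yb P = 0.
  move=> P0; have := specializes_deval derM derE gd dM_base_const constMP const_y
    iM P spb.
  have := rmorph_deval iM (pair2 eta xi) P fd; rewrite P0 rmorph0.
  have -> : deval (f \o iM) dE (f \o pair2 eta xi) P =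
            deval (g \o iM) dE (f \o pair2 eta xi) P.
    by apply: eq_deval => // c /=; rewrite fgK.
  by move=> <-; exact: (specializes0 derM derE gd constMP const_y y0Pg).
have kn : iM (ratC a0) != 0 by rewrite (fmorph_eq0 base_const a0).
have kV : iM (ratC a0^-1) = (iM (ratC a0))^-1 := fmorphV base_const a0.
have kN : iM (ratC (- b0)) = - iM (ratC b0) := rmorphN base_const b0.
have ya0 : ya 0 = eta * iM (ratC a0) by [].
have ya1 : ya 1 = xi * (iM (ratC a0))^-1 + eta * iM (ratC b0) by rewrite -kV.
have yb0 : yb 0 = eta * (iM (ratC a0))^-1 by rewrite -kV.
have yb1 : yb 1 = xi * iM (ratC a0) + eta * - iM (ratC b0) by rewrite -kN.
have [||v|s [sbij sd sK sy]] := @differential_automorphism _ _ _ _ iM dM derM.1 (pair2 eta xi) ya.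
- move=> P; split; first exact: imp_a.
  (* [sig] substitutes the matrix into P; evaluated at [yb], the two transformations cancel. *)
  pose sig (v : 'I_2) : dpoly (ratfield F) (option 'I_m) 'I_2 :=
    pair2 (DMul (DVar _ _ 0) (DConst _ _ (ratC a0)))
      (DAdd (DMul (DVar _ _ 1) (DConst _ _ (ratC a0^-1)))
            (DMul (DVar _ _ 0) (DConst _ _ (ratC b0)))) v.
  have sigE : deval iM dM (pair2 eta xi) (dsubst sig P) = deval iM dM ya P.
    by rewrite deval_subst; apply: eq_deval => //; apply: ord2_ind.
  rewrite -sigE => /imp_b; rewrite deval_subst => <-; apply: eq_deval => //.
  apply: ord2_ind.
    by change (eta = yb 0 * iM (ratC a0)); rewrite yb0 mulfVK.
  change (xi = yb 1 * iM (ratC a0^-1) + yb 0 * iM (ratC b0)).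
  by rewrite kV yb0 yb1; field.
- exact: dgenerated_basis.
- move: v; apply: ord2_ind => P subP PK Pya;
    have [PD PM P0 P1 PV] := dsubfieldP subP; have [_ PB _ _] := subP.
    have := PM _ _ (Pya 0) (PK (ratC a0^-1)); rewrite kV ya0.
    by rewrite mulfK.
  have := PM _ _ (PB _ _ (Pya 1) (PM _ _ (PM _ _ (Pya 0) (PK (ratC a0^-1))) (PK (ratC b0))))
    (PK (ratC a0)).
  rewrite kV ya0 ya1; congr P; rewrite [RHS](_ : _ = xi) //; field.
  exact: kn.
apply/gal_tri_mx; exists s; split=> //; split.
  by rewrite (sy 0) mulrC.
by rewrite (sy 1) /= addrC mulrC; congr (_ + _); rewrite mulrC.
Qed.

End Embeddings.
End GaloisPoint.

(** * Linear differential operators *)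

Definition drow (m : nat) (F E : fieldType) (f : F -> E) (d : 'I_m -> E -> E)
    (c : 'rV[F]_m) (a : E) : E := \sum_l f (c 0 l) * d l a.

Definition dcomb (m : nat) (F : fieldType) (V : Type) (c : 'rV[F]_m)
    (t : dpoly F 'I_m V) : dpoly F 'I_m V :=
  foldr (fun l => DAdd (DMul (DConst _ _ (c 0 l)) (DDer l t))) (DConst _ _ 0)
    (enum 'I_m).

Lemma deval_dcomb (m : nat) (F E : fieldType) (V : Type) (f : F -> E)
    (d : 'I_m -> E -> E) (y : V -> E) (c : 'rV[F]_m) (t : dpoly F 'I_m V) :
  f 0 = 0 -> deval f d y (dcomb c t) = drow f d c (deval f d y t).
Proof.
move=> f0; rewrite /drow /dcomb -big_enum /=.
by elim: (enum _) => [|l s IH] /=; rewrite ?big_nil // big_cons IH.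
Qed.

Lemma drow_der (m : nat) (F E : fieldType) (f : F -> E) (d : 'I_m -> E -> E)
    (c : 'rV[F]_m) :
  (forall l, derivation (d l)) -> derivation (drow f d c).
Proof.
move=> derd; split=> a b; rewrite /drow.
  by rewrite -big_split; apply: eq_bigr => l _; rewrite (derd l).1 mulrDr.
rewrite big_distrl big_distrr -big_split; apply: eq_bigr => l _ /=.
by rewrite (derd l).2; ring.
Qed.

(* Linear differential operators, as differential polynomial expressions in one
   unknown, so that they can be evaluated in every extension of [F]; [X] is the
   set of derivations allowed. *)
Inductive lin_op (m : nat) (F : fieldType) (X : 'rV[F]_m -> Prop) :
    dpoly F 'I_m unit -> Prop :=
  | lin_var : lin_op X (DVar _ _ tt)
  | lin_add s t : lin_op X s -> lin_op X t -> lin_op X (DAdd s t)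
  | lin_scale a t : lin_op X t -> lin_op X (DMul (DConst _ _ a) t)
  | lin_der c t : X c -> lin_op X t -> lin_op X (dcomb c t).

Lemma lin_op_sub (m : nat) (F : fieldType) (X Y : 'rV[F]_m -> Prop) t :
  (forall c, X c -> Y c) -> lin_op X t -> lin_op Y t.
Proof.
move=> XY; elim=> [|? ? _ ? _ ?|? ? _ ?|? ? /XY ? _ ?].
- exact: lin_var.
- exact: lin_add.
- exact: lin_scale.
- exact: lin_der.
Qed.

Lemma lin_opD (m : nat) (F E : fieldType) (X : 'rV[F]_m -> Prop) (f : F -> E)
    (d : 'I_m -> E -> E) t x y : f 0 = 0 -> (forall l, derivation (d l)) ->
  lin_op X t -> deval f d (fun=> x + y) t =
  deval f d (fun=> x) t + deval f d (fun=> y) t.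
Proof.
move=> f0 derd; elim=> //= [s s' _ -> _ ->|a s _ ->|c s _ _ IH].
- by rewrite addrACA.
- by rewrite mulrDr.
- by rewrite !deval_dcomb // IH (drow_der f c derd).1.
Qed.

Lemma lin_opM (m : nat) (F E : fieldType) (X : 'rV[F]_m -> Prop) (f : F -> E)
    (d : 'I_m -> E -> E) t a x : f 0 = 0 -> (forall l, derivation (d l)) ->
  (forall c, X c -> drow f d c a = 0) ->
  lin_op X t -> deval f d (fun=> a * x) t = a * deval f d (fun=> x) t.
Proof.
move=> f0 derd Xa; elim=> //= [s s' _ -> _ ->|b s _ ->|c s Xc _ IH].
- by rewrite mulrDr.
- by rewrite mulrCA.
- by rewrite !deval_dcomb // IH (drow_der f c derd).2 Xa // mul0r add0r.
Qed.

Lemma char0_poly_nat (F : fieldType) (R : {poly F}) :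
  [pchar F] =i pred0 -> (forall k : nat, R.[k%:R] = 0) -> R = 0.
Proof.
move=> charF R0; apply/eqP; apply: contraT => Rn0.
have := max_poly_roots (rs := [seq k%:R | k <- iota 0 (size R)]) Rn0.
rewrite size_map size_iota ltnn => H; apply: H.
  by apply/allP => _ /mapP[k _ ->]; apply/rootP.
rewrite map_inj_in_uniq ?iota_uniq // => j k _ _ /eqP.
wlog jk : j k / (j <= k)%N.
  by move=> W; case/orP: (leq_total j k) => [/W//|/W H]; rewrite eq_sym => /H.
rewrite -subr_eq0 -opprB oppr_eq0 -natrB // ((pcharf0P F).1 charF) subn_eq0 => kj.
by apply/eqP; rewrite eqn_leq jk.
Qed.

Section Operators.
Variables (m : nat) (F : fieldType) (dF : 'I_m -> F -> F).
Hypotheses (charF : [pchar F] =i pred0) (derF : commuting_derivations dF).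

Let D (c : 'rV[F]_m) := drow id dF c.
Let val (t : dpoly F 'I_m unit) (b : F) := deval id dF (fun=> b) t.

Lemma drow_id_der c : derivation (D c). Proof. exact: drow_der derF.1. Qed.

Lemma val_dcomb c t b : val (dcomb c t) b = D c (val t b).
Proof. exact: deval_dcomb. Qed.

Lemma drowD c c' a : D (c + c') a = D c a + D c' a.
Proof.
by rewrite /D /drow -big_split; apply: eq_bigr => l _; rewrite mxE mulrDl.
Qed.

Lemma drowZ s c a : D (s *: c) a = s * D c a.
Proof.
by rewrite /D /drow big_distrr; apply: eq_bigr => l _; rewrite mxE /= mulrA.
Qed.

Definition bracket (c c' : 'rV[F]_m) : 'rV[F]_m :=
  \row_l (D c (c' 0 l) - D c' (c 0 l)).

(** The second order parts are symmetric because the [dF] commute, so they cancel. *)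
Lemma drow_bracket c c' a : D (bracket c c') a = D c (D c' a) - D c' (D c a).
Proof.
have DDE e e' : D e (D e' a) = \sum_l D e (e' 0 l) * dF l a +
    \sum_l \sum_k e 0 k * e' 0 l * dF k (dF l a).
  rewrite {2}/D /drow (big_morph _ (drow_id_der e).1 (der0 (drow_id_der e))) -big_split.
  apply: eq_bigr => l _; rewrite (drow_id_der e).2; congr (_ + _).
  by rewrite [D e _]/D /drow big_distrr; apply: eq_bigr => k _; rewrite /=; ring.
have sym : \sum_l \sum_k c 0 k * c' 0 l * dF k (dF l a) =
           \sum_l \sum_k c' 0 k * c 0 l * dF k (dF l a).
  rewrite exchange_big; apply: eq_bigr => k _; apply: eq_bigr => l _.
  by rewrite (derF.2 k l) /=; ring.
rewrite !DDE sym.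
rewrite opprD addrACA subrr addr0 -sumrB; apply: eq_bigr => l _.
by rewrite mxE; ring.
Qed.

(** * Splitting off one derivation *)

Section OneDerivation.
Variables (X : 'rV[F]_m -> Prop) (a : F) (c1 : 'rV[F]_m).
Hypotheses (XD : forall c c', X c -> X c' -> X (c + c')).
Hypotheses (XZ : forall s c, X c -> X (s *: c)).
Hypothesis Xbracket : forall c c', X c -> X c' -> X (bracket c c').
Hypotheses (Xc1 : X c1) (c1a : D c1 a = a) (a0 : a != 0).

Let Y c := X c /\ D c a = 0.

(** Sums of c1^n t_n with [c1] on the left and t_n in the derivations killing [a]. Powers of [a]
    commute with t_n, so in this form conjugation by them affects [c1] only. *)
Inductive normal_form : (F -> F) -> Prop :=
  | nf_op t : lin_op Y t -> normal_form (val t)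
  | nf_add h h' : normal_form h -> normal_form h' ->
      normal_form (fun b => h b + h' b)
  | nf_der h : normal_form h -> normal_form (fun b => D c1 (h b)).

Lemma nf_scale h s : normal_form h -> normal_form (fun b => s * h b).
Proof.
move=> hN; elim: hN s => [t tY|h1 h2 _ IH1 _ IH2|h1 _ IH] s.
- exact: (nf_op (lin_scale s tY)).
- rewrite (_ : (fun b => _) = fun b => s * h1 b + s * h2 b).
    exact: nf_add.
  by apply/funext => b; rewrite mulrDr.
- rewrite (_ : (fun b => _) = fun b => D c1 (s * h1 b) + - D c1 s * h1 b).
    by apply: nf_add; [apply: nf_der; exact: IH | exact: IH].
  by apply/funext => b; rewrite (drow_id_der c1).2; ring.
Qed.

(** Since c1(a) = a and c(a) = 0, the bracket of [c] and [c1] kills [a]; moving [c] to the right of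
    [c1] stays within [Y]. *)
Lemma nf_derY h c : Y c -> normal_form h -> normal_form (fun b => D c (h b)).
Proof.
move=> + hN; elim: hN c => [t tY|h1 h2 _ IH1 _ IH2|h1 _ IH] c Yc.
- rewrite (_ : (fun b => _) = val (dcomb c t)); last first.
    by apply/funext => b; rewrite val_dcomb.
  exact: nf_op (lin_der Yc tY).
- rewrite (_ : (fun b => _) = fun b => D c (h1 b) + D c (h2 b)).
    by apply: nf_add; [exact: IH1 | exact: IH2].
  by apply/funext => b; rewrite (drow_id_der c).1.
- have Yb : Y (bracket c c1).
    case: Yc => Xc ca; split; first exact: Xbracket.
    by rewrite drow_bracket c1a ca (der0 (drow_id_der c1)) subrr.
  rewrite (_ : (fun b => _) =
      fun b => D c1 (D c (h1 b)) + D (bracket c c1) (h1 b)).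
    by apply: nf_add; [apply: nf_der; exact: IH | exact: IH].
  by apply/funext => b; rewrite drow_bracket; ring.
Qed.

Lemma lin_op_nf t : lin_op X t -> normal_form (val t).
Proof.
elim=> [|s s' _ IH _ IH'|s s' _ IH|c s Xc _ IH].
- exact: nf_op (lin_var _).
- exact: nf_add.
- exact: nf_scale.
(* [c] is e c1 plus a derivation killing [a]. *)
- pose e := D c a / a.
  have Y' : Y (c - e *: c1).
    split; first by rewrite -scaleNr; apply/XD => //; apply: XZ.
    by rewrite -scaleNr drowD drowZ c1a mulNr divfK // subrr.
  rewrite (_ : val _ = fun b => D (c - e *: c1) (val s b) + e * D c1 (val s b)).
    apply: nf_add; first exact: nf_derY.
    exact: nf_scale (nf_der IH).
  by apply/funext => b; rewrite val_dcomb -scaleNr drowD drowZ; ring.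
Qed.

Lemma iter_drow0 n : iter n (D c1) 0 = 0.
Proof. by elim: n => //= n ->; rewrite (der0 (drow_id_der c1)). Qed.

(** The coefficients form an infinite sequence acting as zero from [N] on, so that two expansions
    can be padded to a common length. *)
Lemma nf_coefs h : normal_form h ->
  exists (N : nat) (t : nat -> dpoly F 'I_m unit),
    [/\ forall n, lin_op Y (t n), forall n b, (N <= n)%N -> val (t n) b = 0 &
        forall b, h b = \sum_(n < N) iter n (D c1) (val (t n) b)].
Proof.
have Y0 : lin_op Y (DMul (DConst _ _ 0) (DVar _ _ tt)) by apply/lin_scale/lin_var.
have extend N (t : nat -> dpoly F 'I_m unit) b k :
    (forall n b, (N <= n)%N -> val (t n) b = 0) ->
    \sum_(n < N) iter n (D c1) (val (t n) b) =
    \sum_(n < N + k) iter n (D c1) (val (t n) b).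
  move=> t0; rewrite big_split_ord /= [X in _ = _ + X]big1 ?addr0 // => i _.
  by rewrite t0 ?leq_addr // iter_drow0.
elim=> [t tY|h1 h2 _ [N [t [tY t0 tE]]] _ [N' [t' [tY' t0' tE']]]|h1 _ [N [t [tY t0 tE]]]].
- exists 1%N, (fun n => if n is _.+1 then DMul (DConst _ _ 0) (DVar _ _ tt) else t).
  split=> [[|n]|[|n] b|b] //; first by rewrite /val /= mul0r.
  by rewrite big_ord1.
- exists (N + N')%N, (fun n => DAdd (t n) (t' n)); split=> [n|n b le|b].
  + exact: lin_add.
  + rewrite /val /= -/(val _ _) -/(val _ _) t0 ?t0' ?addr0 //.
      exact: leq_trans (leq_addl _ _) le.
    exact: leq_trans (leq_addr _ _) le.
  + rewrite tE tE' (extend _ _ _ N' t0) (extend N' _ _ N t0') addnC -big_split /=.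
    apply: eq_bigr => i _; rewrite /val /= -/(val _ _) -/(val _ _).
    by elim: (nat_of_ord i) (val (t i) b) (val (t' i) b) => //= n IH x y; rewrite -IH (drow_id_der c1).1.
- exists N.+1, (fun n => if n is k.+1 then t k else DMul (DConst _ _ 0) (DVar _ _ tt)).
  split=> [[|n]|[|n] b|b] //; first exact: t0.
  rewrite big_ord_recl /= {1}/val /= mul0r add0r tE.
  rewrite (big_morph _ (drow_id_der c1).1 (der0 (drow_id_der c1))).
  by apply: eq_bigr => i _.
Qed.

Lemma iter_drow_pow n k v :
  iter n (D c1) (a ^+ k * v) = a ^+ k * iter n (fun w => D c1 w + k%:R * w) v.
Proof.
have Dpow : D c1 (a ^+ k) = k%:R * a ^+ k.
  elim: k => [|k IH]; first by rewrite expr0 (der1 (drow_id_der c1)) mul0r.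
  by rewrite exprS (drow_id_der c1).2 c1a IH -natr1; ring.
elim: n => //= n ->; rewrite (drow_id_der c1).2 Dpow; ring.
Qed.

(** Integers are killed by [c1], so each application of D + k turns Q(k) into (D Q)(k) + k Q(k),
    where D acts on coefficients: the degree grows by one and the leading coefficient stays [v]. *)
Lemma iter_shift_poly n v : exists Q : {poly F},
  [/\ (size Q <= n.+1)%N, Q`_n = v &
      forall k : nat, iter n (fun w => D c1 w + k%:R * w) v = Q.[k%:R]].
Proof.
have D0 := der0 (drow_id_der c1).
elim: n => [|n [Q [szQ Qn QE]]].
  by exists v%:P; rewrite coefC size_polyC; split=> // [|k]; [case: (v != 0) | rewrite hornerC].
have sz : (size (map_poly (D c1) Q) <= n.+1)%N by apply: leq_trans (size_poly _ _) szQ.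
exists (map_poly (D c1) Q + 'X * Q); split=> [||k].
- apply: leq_trans (size_polyD _ _) _; rewrite geq_max (leq_trans sz) // mulrC.
  have [->|Q0] := eqVneq Q 0; first by rewrite mul0r size_poly0.
  by rewrite size_mulX.
- rewrite coefD coef_map_id0 // coefXM /= Qn nth_default ?(leq_trans szQ) //.
  by rewrite D0 add0r.
- rewrite /= QE hornerD hornerM hornerX; congr (_ + _).
  have Dk j : D c1 (k%:R ^+ j) = 0.
    elim: j => [|j IH]; first by rewrite expr0 (der1 (drow_id_der c1)).
    rewrite exprS (drow_id_der c1).2 IH mulr0 addr0.
    suff -> : D c1 k%:R = 0 by rewrite mul0r.
    by elim: (k) => // l IHl; rewrite -natr1 (drow_id_der c1).1 IHl (der1 (drow_id_der c1)) addr0.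
  rewrite (horner_coef_wide _ sz) (horner_coef_wide _ szQ).
  rewrite (big_morph _ (drow_id_der c1).1 D0); apply: eq_bigr => i _.
  by rewrite (drow_id_der c1).2 Dk mulr0 addr0 coef_map_id0.
Qed.

Lemma shift_coefs_kill (B : F -> Prop) (tau : nat -> F -> F) N :
  (forall b, B b -> B (a * b)) ->
  (forall n k b, tau n (a ^+ k * b) = a ^+ k * tau n b) ->
  (forall b, B b -> \sum_(n < N) iter n (D c1) (tau n b) = 0) ->
  forall n, (n < N)%N -> forall b, B b -> tau n b = 0.
Proof.
move=> aB tauM; have akB k b : B b -> B (a ^+ k * b).
  by move=> Bb; elim: k => [|k IH]; rewrite ?mul1r // exprS -mulrA; apply: aB.
elim: N => [|N IH] // tau0.
have tauN b : B b -> tau N b = 0.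
  move=> Bb; have [Q QP] := choice (fun n => iter_shift_poly n (tau n b)).
  (* At k, [R] is the equation for a^k b divided by a^k. Only the summand of index [N] reaches
     degree [N]. *)
  pose R := \sum_(n < N.+1) Q n.
  have <- : R`_N = tau N b.
    rewrite /R coef_sum big_ord_recr /= big1 ?add0r => [|i _].
      by case: (QP N).
    by case: (QP i) => sz _ _; rewrite nth_default // (leq_trans sz).
  rewrite (_ : R = 0) ?coef0 //; apply: char0_poly_nat => // k.
  have := tau0 _ (akB k _ Bb); rewrite /R horner_sum.
  under eq_bigr do rewrite tauM iter_drow_pow.
  rewrite -big_distrr /= => /eqP; rewrite mulf_eq0 expf_eq0 (negPf a0) andbF /=.
  by move=> /eqP E; rewrite -[RHS]E; apply: eq_bigr => i _; case: (QP i).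
move=> n; rewrite ltnS leq_eqVlt => /orP[/eqP->//|]; apply: IH => b Bb.
by have := tau0 _ Bb; rewrite big_ord_recr /= tauN // iter_drow0 addr0.
Qed.

Lemma killers_step (B : F -> Prop) (b0 : F) : (forall b, B b -> B (a * b)) ->
  (forall t, lin_op Y t -> (forall b, B b -> val t b = 0) -> val t b0 = 0) ->
  forall t, lin_op X t -> (forall b, B b -> val t b = 0) -> val t b0 = 0.
Proof.
move=> aB GY t tX tB; have [N [tau [tauY tau0 tE]]] := nf_coefs (lin_op_nf tX).
have Da k c : Y c -> D c (a ^+ k) = 0.
  case=> _ ca; elim: k => [|k IH]; first by rewrite expr0 (der1 (drow_id_der c)).
  by rewrite exprS (drow_id_der c).2 ca IH mul0r mulr0 addr0.
have tauM n k b : val (tau n) (a ^+ k * b) = a ^+ k * val (tau n) b.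
  by apply: (lin_opM (X := Y)) => // [|c]; [exact: derF.1 | exact: Da].
have sum0 b : B b -> \sum_(n < N) iter n (D c1) (val (tau n) b) = 0.
  by move=> Bb; rewrite -tE tB.
have kill := shift_coefs_kill (tau := fun n => val (tau n)) aB tauM sum0.
rewrite tE big1 // => i _; rewrite (GY (tau i)) ?iter_drow0 // => b; exact: (kill i (ltn_ord i)).
Qed.

End OneDerivation.
End Operators.

(** [L] is any set of vectors and the family is taken inside [L]: one of maximal rank spans. *)
Lemma finite_spanning_family (F : fieldType) (n : nat) (L : 'rV[F]_n -> Prop) :
  exists (r : nat) (N : 'M[F]_(r, n)),
    (forall i, L (row i N)) /\ (forall v, L v -> (v <= N)%MS).
Proof.
pose P k := `[< exists (r : nat) (N : 'M[F]_(r, n)),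
  (forall i, L (row i N)) /\ \rank N = k >].
have P0 : exists k, P k.
  exists 0%N; apply/asboolP; exists 0%N, 0.
  by split=> [[]//|]; exact: mxrank0.
have Pn k : P k -> (k <= n)%N.
  by move=> /asboolP[r [N [_ <-]]]; exact: rank_leq_col.
case: (ex_maxnP P0 Pn) => k /asboolP[r [N [LN rkN]]] kmax.
exists r, N; split=> // v Lv; pose N' := col_mx v N.
have NN' : (N <= N')%MS by rewrite -addsmxE addsmxSr.
have vN' : (v <= N')%MS by rewrite -addsmxE addsmxSl.
apply: submx_trans vN' _.
have [_ <-] := mxrank_leqif_sup NN'.
rewrite eqn_leq (mxrankS NN') rkN; apply: kmax; apply/asboolP.
exists (1 + r)%N, N'; split=> // i.
case: (splitP i) => j ij.
  by rewrite (_ : i = lshift r j) ?rowKu ?row_id //; apply: val_inj.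
by rewrite (_ : i = rshift 1 j) ?rowKd //; apply: val_inj.
Qed.

Lemma not_submx_functional (F : fieldType) (r n : nat) (N : 'M[F]_(r, n))
    (v : 'rV[F]_n) : ~~ (v <= N)%MS ->
  exists c : 'cV[F]_n, N *m c = 0 /\ (v *m c) 0 0 != 0.
Proof.
rewrite submxE => /rV0Pn[j vj]; exists (col j (cokermx N)).
have colE k (w : 'M[F]_(k, n)) i :
    (w *m col j (cokermx N)) i 0 = (w *m cokermx N) i j.
  by rewrite !mxE; apply: eq_bigr => l _; rewrite mxE.
by split; [apply/colP => i; rewrite colE mulmx_coker !mxE | rewrite colE].
Qed.

(** * Equations of additive subgroups *)

Section LinearClosure.
Variables (m : nat) (F : fieldType) (dF : 'I_m -> F -> F).
Hypotheses (charF : [pchar F] =i pred0) (derF : commuting_derivations dF).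

Let D (c : 'rV[F]_m) := drow id dF c.
Let val (t : dpoly F 'I_m unit) (b : F) := deval id dF (fun=> b) t.

(** Finitely many elements of [A] determine the derivations killing [A], since their rows of
    derivatives span all the others. They are dropped one at a time; each drop either leaves the set
    of allowed derivations unchanged or is an instance of [killers_step]. *)
Lemma constant_killers (A B : F -> Prop) (b0 : F) :
  (forall a, A a -> a != 0) -> (forall a b, A a -> B b -> B (a * b)) ->
  (forall t, lin_op (annihilating_der dF A) t ->
     (forall b, B b -> val t b = 0) -> val t b0 = 0) ->
  forall t, lin_op (fun=> True) t -> (forall b, B b -> val t b = 0) ->
    val t b0 = 0.
Proof.
move=> A0 AB GA.
pose X (s : seq F) c := forall a, a \in s -> D c a = 0.
pose G s := forall t, lin_op (X s) t -> (forall b, B b -> val t b = 0) -> val t b0 = 0.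
suff GX s : (forall a, a \in s -> A a) -> G s -> G [::].
  have [r [N [LN Nspan]]] :=
    finite_spanning_family (fun v => exists a, A a /\ v = \row_l dF l a).
  have [f fP] := choice LN.
  have G0 : G [seq f i | i <- enum 'I_r].
    move=> t tX; apply: GA; apply: lin_op_sub tX => c cX a Aa.
    have Dmx x : D c x = ((\row_l dF l x) *m c^T) 0 0.
      by rewrite mxE; apply: eq_bigr => l _; rewrite !mxE mulrC.
    have /Nspan/submxP[U] : exists a', A a' /\ \row_l dF l a = \row_l dF l a' by exists a.
    move=> aE; change (D c a = 0); rewrite Dmx aE -mulmxA (_ : N *m c^T = 0).
      by rewrite mulmx0 mxE.
    apply/matrixP => i j; rewrite ord1 [RHS]mxE.
    have := cX (f i); rewrite Dmx -(fP i).2 -row_mul mxE; apply.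
    by apply: map_f; rewrite mem_enum.
  have /GX : forall a, a \in [seq f i | i <- enum 'I_r] -> A a.
    by move=> _ /mapP[i _ ->]; exact: (fP i).1.
  move=> /(_ G0) GE t tT; apply: GE; apply: lin_op_sub tT => c _ a.
  by rewrite in_nil.
elim: s => [|a s IH] // sA Gas.
apply: IH => [x xs|t tX tB]; first by apply: sA; rewrite inE xs orbT.
have Aa : A a by apply: sA; rewrite mem_head.
have as_sub (Y : 'rV[F]_m -> Prop) t' : lin_op Y t' ->
    (forall c, Y c -> X s c /\ D c a = 0) -> lin_op (X (a :: s)) t'.
  move=> tY YX; apply: lin_op_sub tY => c /YX[cs ca] x.
  by rewrite inE => /orP[/eqP->//|/cs].
have [Xa|] := pselect (forall c, X s c -> D c a = 0).
  by apply: Gas => //; apply: as_sub tX _ => c Xc; split=> //; exact: Xa.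
move=> /existsNP[c /not_implyP[Xc /eqP ca]].
have XD c' c'' : X s c' -> X s c'' -> X s (c' + c'').
  by move=> X1 X2 x xs; rewrite /D drowD [drow _ _ c' x]X1 // [drow _ _ c'' x]X2 // addr0.
have XZ k c' : X s c' -> X s (k *: c').
  by move=> X1 x xs; rewrite /D drowZ [drow _ _ c' x]X1 // mulr0.
have Xbr c' c'' : X s c' -> X s c'' -> X s (bracket dF c' c'').
  move=> X1 X2 x xs; rewrite /D drow_bracket //.
  rewrite [drow _ _ c'' x]X2 // [drow _ _ c' x]X1 //.
  by rewrite !(der0 (drow_id_der derF _)) subrr.
(* With the normalization c1(a) = a, conjugation by a^k shifts [c1] by the integer k. *)
pose c1 := (a / D c a) *: c.
have c1a : D c1 a = a by rewrite /D drowZ -/(D _) divfK.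
apply: (killers_step charF derF XD XZ Xbr (XZ _ _ Xc) c1a (A0 _ Aa)) tX tB.
  by move=> b; apply: AB.
by move=> t' t'Y; apply: Gas; apply: as_sub t'Y _.
Qed.

(** The argument on spans only restricts polynomials to lines, and this property passes to sums and
    products without handling monomials. *)
Definition line_poly n (p : 'rV[F]_n -> F) : Prop :=
  forall v w, exists Q : {poly F}, forall c, p (v + c *: w) = Q.[c].

Definition op_vector n (v : F -> 'rV[F]_n) : Prop :=
  forall j, exists2 t, lin_op (fun=> True) t & forall b, v b 0 j = val t b.

(** Algebraic polynomials in linear operators. The class is closed under derivations by the Leibniz
    rule, hence contains every differential polynomial function of one unknown. *)
Inductive op_poly : (F -> F) -> Prop :=
  | op_poly_op t : lin_op (fun=> True) t -> op_poly (val t)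
  | op_poly_const c : op_poly (fun=> c)
  | op_poly_add h h' : op_poly h -> op_poly h' -> op_poly (fun b => h b + h' b)
  | op_poly_mul h h' : op_poly h -> op_poly h' -> op_poly (fun b => h b * h' b).

Lemma op_poly_der h i : op_poly h -> op_poly (fun b => dF i (h b)).
Proof.
elim=> [t tT|c|h1 h2 H1 IH1 H2 IH2|h1 h2 H1 IH1 H2 IH2].
- rewrite (_ : (fun b => _) = val (dcomb (delta_mx 0 i) t)).
    exact/op_poly_op/lin_der.
  apply/funext => b; rewrite /val deval_dcomb // /drow (bigD1 i) //= mxE !eqxx mul1r.
  by rewrite big1 ?addr0 // => l /negPf li; rewrite mxE li andbF mul0r.
- exact: op_poly_const.
- rewrite (_ : (fun b => _) = fun b => dF i (h1 b) + dF i (h2 b)).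
    exact: op_poly_add.
  by apply/funext => b; rewrite (derF.1 i).1.
- rewrite (_ : (fun b => _) = fun b => dF i (h1 b) * h2 b + h1 b * dF i (h2 b)).
    by apply: op_poly_add; apply: op_poly_mul.
  by apply/funext => b; rewrite (derF.1 i).2.
Qed.

Lemma dpoly_op_poly (t : dpoly F 'I_m unit) : op_poly (val t).
Proof.
elim: t => [[]|c|s IHs t IHt|s IHs t IHt|i t IH].
- exact/op_poly_op/lin_var.
- exact: op_poly_const.
- exact: op_poly_add IHs IHt.
- exact: op_poly_mul IHs IHt.
- exact: op_poly_der IH.
Qed.

Lemma op_vector_row n n' (v : F -> 'rV[F]_n) (v' : F -> 'rV[F]_n') :
  op_vector v -> op_vector v' -> op_vector (fun b => row_mx (v b) (v' b)).
Proof.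
move=> H H' j; case: (splitP j) => k jk.
  have [t tT tE] := H k; exists t => // b; rewrite -tE -(row_mxEl (v b) (v' b)).
  by congr (_ _ _); apply: val_inj.
have [t tT tE] := H' k; exists t => // b; rewrite -tE -(row_mxEr (v b) (v' b)).
by congr (_ _ _); apply: val_inj.
Qed.

Lemma op_poly_line h : op_poly h ->
  exists n (v : F -> 'rV[F]_n) (p : 'rV[F]_n -> F),
    [/\ op_vector v, line_poly p & forall b, h b = p (v b)].
Proof.
elim=> [t tT|c|h1 h2 _ [n [v [p [vo pl hE]]]] _ [n' [v' [p' [vo' pl' hE']]]]
       |h1 h2 _ [n [v [p [vo pl hE]]]] _ [n' [v' [p' [vo' pl' hE']]]]].
- exists 1%N, (fun b => const_mx (val t b)), (fun v => v 0 0).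
  split=> [j|v w|b]; last by rewrite mxE.
    by exists t => // b; rewrite mxE.
  by exists ((v 0 0)%:P + (w 0 0) *: 'X) => c; rewrite !mxE !hornerE mulrC.
- exists 0%N, (fun=> 0), (fun=> c); split=> // [[]//|v w].
  by exists c%:P => x; rewrite hornerC.
- exists (n + n')%N, (fun b => row_mx (v b) (v' b)).
  exists (fun w => p (lsubmx w) + p' (rsubmx w)); split=> [|w w'|b].
  + exact: op_vector_row.
  + have [Q QE] := pl (lsubmx w) (lsubmx w').
    have [Q' QE'] := pl' (rsubmx w) (rsubmx w').
    by exists (Q + Q') => c; rewrite hornerD -QE -QE' !linearD !linearZ.
  + by rewrite row_mxKl row_mxKr hE hE'.
- exists (n + n')%N, (fun b => row_mx (v b) (v' b)).
  exists (fun w => p (lsubmx w) * p' (rsubmx w)); split=> [|w w'|b].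
  + exact: op_vector_row.
  + have [Q QE] := pl (lsubmx w) (lsubmx w').
    have [Q' QE'] := pl' (rsubmx w) (rsubmx w').
    by exists (Q * Q') => c; rewrite hornerM -QE -QE' !linearD !linearZ.
  + by rewrite row_mxKl row_mxKr hE hE'.
Qed.

Lemma op_vector_functional n (v : F -> 'rV[F]_n) (c : 'cV[F]_n) : op_vector v ->
  exists2 t, lin_op (fun=> True) t & forall b, (v b *m c) 0 0 = val t b.
Proof.
move=> vo.
suff H s : exists2 t, lin_op (fun=> True) t &
    forall b, \sum_(j <- s) v b 0 j * c j 0 = val t b.
  have [t tT tE] := H (index_enum 'I_n); exists t => // b; rewrite -tE mxE.
  by [].
elim: s => [|j s [t tT tE]].
  exists (DMul (DConst _ _ 0) (DVar _ _ tt)) => [|b]; first exact/lin_scale/lin_var.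
  by rewrite big_nil /val /= mul0r.
have [t' t'T t'E] := vo j.
exists (DAdd (DMul (DConst _ _ (c j 0)) t') t) => [|b].
  by apply: lin_add => //; exact: lin_scale.
by rewrite big_cons tE t'E /val /= mulrC.
Qed.

Lemma op_vectorB n (v : F -> 'rV[F]_n) b b' : op_vector v ->
  v (b - b') = v b - v b'.
Proof.
move=> vo; apply/rowP => j; have [t tT tE] := vo j; rewrite !mxE !tE.
apply/eqP; rewrite eq_sym subr_eq; apply/eqP.
rewrite -[in LHS](subrK b' b); apply: (lin_opD (X := fun=> True)) => //.
exact: derF.1.
Qed.

(* A polynomial vanishing on a subgroup of [F^n] vanishes on its linear span in
   characteristic zero, so the equations of a subgroup of [G_a] may be taken
   linear. *)
Lemma additive_linear_closure (B : F -> Prop) (b0 : F) :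
  B 0 -> (forall b b', B b -> B b' -> B (b - b')) ->
  (forall t, lin_op (fun=> True) t -> (forall b, B b -> val t b = 0) ->
     val t b0 = 0) ->
  forall t, (forall b, B b -> val t b = 0) -> val t b0 = 0.
Proof.
move=> B0 BB lin t tB.
have [n [v [p [vo pl tE]]]] := op_poly_line (dpoly_op_poly t).
pose L w := exists b, B b /\ w = v b.
have LB w w' : L w -> L w' -> L (w - w').
  by move=> [b [Bb ->]] [b' [Bb' ->]]; exists (b - b'); split; [exact: BB | rewrite op_vectorB].
have L0 : L 0.
  by rewrite -(subrr (v 0)) -op_vectorB // subrr; exists 0.
have LD w w' : L w -> L w' -> L (w + w').
  by move=> Lw Lw'; rewrite -[w']opprK -[- w']sub0r; apply/LB/LB.
have Lnat w k : L w -> L (k%:R *: w).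
  move=> Lw; elim: k => [|k IH]; first by rewrite scale0r.
  by rewrite -natr1 scalerDl scale1r; apply: LD.
have [r [N [LN Nspan]]] := finite_spanning_family L.
(* Outside the span, a functional vanishing on [N] would give a linear equation of [B] that [b0]
   violates. *)
have [/submxP[U vU]|/not_submx_functional[c [Nc /eqP vc]]] := boolP (v b0 <= N)%MS; last first.
  case: vc; have [s sT sE] := op_vector_functional c vo; rewrite sE.
  apply: lin => // b Bb; rewrite -sE.
  have /Nspan/submxP[U ->] : L (v b) by exists b.
  by rewrite -mulmxA Nc mulmx0 mxE.
rewrite tE vU mulmx_sum_row.
(* Directions are added one at a time. Along [row i N] the polynomial vanishes at every natural
   number, because w + k row remains in [L]; hence it vanishes on the whole line. *)
suff H s w : L w -> p (w + \sum_(i <- s) U 0 i *: row i N) = 0.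
  by have := H (index_enum 'I_r) _ L0; rewrite add0r.
elim: s w => [|i s IH] w Lw.
  by rewrite big_nil addr0; case: Lw => b [Bb ->]; rewrite -tE tB.
rewrite big_cons addrCA addrC.
have [Q QE] := pl (w + \sum_(j <- s) U 0 j *: row j N) (row i N).
rewrite QE (_ : Q = 0) ?horner0 //; apply: char0_poly_nat => // k.
by rewrite -QE addrAC; apply/IH/LD => //; apply: Lnat.
Qed.

End LinearClosure.

(** * The inclusion of operator rings *)

Lemma iter_multi_morph (k : nat) (T T' : Type) (phi : T -> T')
    (D : 'I_k -> T -> T) (D' : 'I_k -> T' -> T') (al : 'X_{1..k}) (t : T) :
  (forall j t, phi (D j t) = D' j (phi t)) ->
  phi (iter_multi D al t) = iter_multi D' al (phi t).
Proof.
move=> phiD; rewrite /iter_multi; elim: (enum _) => //= j s IH.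
by elim: (al j) => //= n IHn; rewrite phiD IHn.
Qed.

Lemma iter_multiU (k : nat) (T : Type) (D : 'I_k -> T -> T) (al : 'X_{1..k})
    (i : 'I_k) (t : T) :
  (forall j j' x, D j (D j' x) = D j' (D j x)) ->
  iter_multi D (al + U_(i)) t = D i (iter_multi D al t).
Proof.
move=> comD; rewrite /iter_multi.
suff H s : uniq s -> foldr (fun j => iter ((al + U_(i))%MM j) (D j)) t s =
    iter (i \in s) (D i) (foldr (fun j => iter (al j) (D j)) t s).
  by rewrite H ?enum_uniq // mem_enum.
elim: s => //= j s IH /andP[js us]; rewrite IH // mnmDE mnm1E inE.
have comI n x : iter n (D j) (D i x) = D i (iter n (D j) x).
  by elim: n => //= n ->; rewrite comD.
have [->|ij] := eqVneq i j.
  by rewrite (negPf js) addn1.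
by rewrite addn0; case: (i \in s) => //=; rewrite comI.
Qed.

Section OperatorAction.
Variables (k : nat) (F : fieldType) (d : 'I_k -> F -> F).
Hypothesis derd : commuting_derivations d.
Variable b : F.

Lemma op_apply_wide (p : {mpoly F[k]}) s : uniq s -> {subset msupp p <= s} ->
  op_apply d p b = \sum_(al <- s) p@_al * iter_multi d al b.
Proof.
move=> us ps; rewrite /op_apply [RHS](bigID (fun al => al \in msupp p)) /=.
rewrite [X in _ + X]big1 => [|al]; last first.
  by move/memN_msupp_eq0 => ->; rewrite mul0r.
rewrite addr0 -[RHS]big_filter; apply: perm_big; apply: uniq_perm.
- exact: msupp_uniq.
- exact: filter_uniq.
- by move=> al; rewrite mem_filter andb_idr // => /ps.
Qed.

Lemma op_applyD (p p' : {mpoly F[k]}) :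
  op_apply d (p + p') b = op_apply d p b + op_apply d p' b.
Proof.
pose s := undup (msupp p ++ msupp p').
have us : uniq s by exact: undup_uniq.
rewrite !(@op_apply_wide _ s) //.
- rewrite -big_split; apply: eq_bigr => al _.
  by rewrite mcoeffD mulrDl.
- by move=> al alp; rewrite mem_undup mem_cat alp orbT.
- by move=> al alp; rewrite mem_undup mem_cat alp.
- by move=> al /msuppD_le; rewrite mem_undup.
Qed.

Lemma op_applyZ c (p : {mpoly F[k]}) :
  op_apply d (c *: p) b = c * op_apply d p b.
Proof.
rewrite (@op_apply_wide _ (msupp p)) ?msupp_uniq //; last exact: msuppZ_le.
by rewrite /op_apply big_distrr; apply: eq_bigr => al _; rewrite mcoeffZ /= mulrA.
Qed.

Lemma op_applyX al : op_apply d 'X_[al] b = iter_multi d al b.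
Proof. by rewrite /op_apply msuppX big_seq1 mcoeffX eqxx mul1r. Qed.

Lemma op_apply0 : op_apply d 0 b = 0.
Proof. by rewrite /op_apply msupp0 big_nil. Qed.

Lemma op_apply1 : op_apply d 1 b = b.
Proof.
rewrite -mpolyX0 op_applyX /iter_multi.
by elim: (enum _) => //= i s ->; rewrite mnm0E.
Qed.

Lemma op_apply_sum (T : Type) (s : seq T) (G : T -> {mpoly F[k]}) :
  op_apply d (\sum_(x <- s) G x) b = \sum_(x <- s) op_apply d (G x) b.
Proof.
by apply: (big_morph (fun p => op_apply d p b)); [exact: op_applyD | exact: op_apply0].
Qed.

Lemma op_apply_lmul i (p : {mpoly F[k]}) :
  op_apply d (op_lmul d i p) b = d i (op_apply d p b).
Proof.
have [dA dM] := derd.1 i.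
have -> : d i (op_apply d p b) =
    \sum_(al <- msupp p) d i p@_al * iter_multi d al b +
    \sum_(al <- msupp p) p@_al * iter_multi d (al + U_(i)) b.
  rewrite -big_split [op_apply d p b]/op_apply (big_morph _ dA (der0 (derd.1 i))).
  by apply: eq_bigr => al _; rewrite dM -(iter_multiU _ _ _ derd.2).
rewrite /op_lmul op_applyD; congr (_ + _).
  have -> : map_mpoly (d i) p = \sum_(al <- msupp p) d i p@_al *: 'X_[al].
    by rewrite /map_mpoly /mmap; apply: eq_bigr => al _; rewrite mmap1_id mul_mpolyC.
  by rewrite op_apply_sum; apply: eq_bigr => al _; rewrite op_applyZ op_applyX.
rewrite [X in _ * X](mpolyE p) big_distrr op_apply_sum; apply: eq_bigr => al _ /=.
by rewrite -scalerAr op_applyZ addmC -mpolyXD op_applyX.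
Qed.

End OperatorAction.

(** Application to [b] is left F-linear and turns [op_lmul] into the derivation itself, so iterated
    products of operators become iterated derivations of Pi'. *)
Lemma op_apply_incl (m k : nat) (F : fieldType) (d : 'I_m -> F -> F)
    (P : 'M[F]_(k, m)) (p : {mpoly F[k]}) (b : F) :
  commuting_derivations d ->
  op_apply d (op_incl d P p) b = op_apply (der_comb P id d) p b.
Proof.
move=> derd; rewrite /op_incl op_apply_sum; apply: eq_bigr => al _.
rewrite op_applyZ; congr (_ * _).
rewrite (iter_multi_morph (phi := fun t => op_apply d t b)
  (D' := der_comb P id d)) ?op_apply1 // => j t.
rewrite op_apply_sum; apply: eq_bigr => i _.
by rewrite op_applyZ op_apply_lmul.
Qed.

(** * Stabilizers and the unipotent part *)

Lemma rmorph_drow (m : nat) (F E E' : fieldType) (f : F -> E)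
    (d : 'I_m -> E -> E) (d' : 'I_m -> E' -> E') (g : {rmorphism E -> E'})
    (c : 'rV[F]_m) (x : E) :
  diff_compatible d d' g -> g (drow f d c x) = drow (g \o f) d' c (g x).
Proof.
move=> gd; rewrite /drow rmorph_sum; apply: eq_bigr => l _.
by rewrite rmorphM gd.
Qed.

Lemma eq_drow (m : nat) (F E : fieldType) (f f' : F -> E) (d : 'I_m -> E -> E)
    (c : 'rV[F]_m) (x : E) : f =1 f' -> drow f d c x = drow f' d c x.
Proof. by move=> ff'; apply: eq_bigr => l _; rewrite ff'. Qed.

Lemma der_combE (m k : nat) (F E : fieldType) (P : 'M[F]_(k, m)) (f : F -> E)
    (d : 'I_m -> E -> E) (i : 'I_k) (x : E) :
  der_comb P f d i x = drow f d (row i P) x.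
Proof. by apply: eq_bigr => l _; rewrite mxE. Qed.

Lemma drow_submx (m k : nat) (F E : fieldType) (P : 'M[F]_(k, m))
    (U : 'rV[F]_k) (f : {rmorphism F -> E}) (d : 'I_m -> E -> E) (x : E) :
  drow f d (U *m P) x = \sum_j f (U 0 j) * der_comb P f d j x.
Proof.
rewrite /drow /der_comb; under [RHS]eq_bigr do rewrite big_distrr.
rewrite exchange_big; apply: eq_bigr => l _; rewrite mxE rmorph_sum big_distrl.
by apply: eq_bigr => j _ /=; rewrite rmorphM mulrA.
Qed.

Lemma der_div (E : fieldType) (D : E -> E) (x y : E) :
  derivation D -> x != 0 -> y != 0 -> D (x / y) = x / y * (D x / x - D y / y).
Proof. by move=> derD x0 y0; rewrite derD.2 (derV derD y0); field; rewrite x0 y0. Qed.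

Lemma fmorph_char0 (F E : fieldType) (f : {rmorphism F -> E}) :
  [pchar F] =i pred0 -> [pchar E] =i pred0.
Proof.
move=> charF; apply/(pcharf0P E) => n.
by rewrite -(rmorph_nat f) fmorph_eq0 ((pcharf0P F).1 charF).
Qed.

Section Stabilizers.
Variables (m : nat) (F : fieldType) (dF : 'I_m -> F -> F).
Hypotheses (charF : [pchar F] =i pred0) (derF : commuting_derivations dF).
Hypothesis closedF : diff_closed dF.
Variable dK : option 'I_m -> ratfield F -> ratfield F.
Hypothesis derK : is_ratfield_der dF dK.
Variables (q : ratfield F) (M : fieldType) (dM : option 'I_m -> M -> M).
Variable iM : {rmorphism ratfield F -> M}.
Hypothesis ppvM : is_PPV dK iM dM (coefs2 q).
Variables eta xi : M.
Hypothesis basisM : solution_basis iM dM (coefs2 q) (pair2 eta xi).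
Variable u : ratfield F.
Hypothesis etaE : dM None eta = iM u * eta.
Hypothesis xi_eta : dM None (xi / eta) = eta ^- 2.
Let H := gal_matrices iM dM (pair2 eta xi).
Variables A B : F -> Prop.
Hypothesis AB : is_triangular_product dF H A B.

Let kap := base_const iM.
Let dPi (E : fieldType) (d : option 'I_m -> E -> E) (i : 'I_m) := d (Some i).

Lemma triangular_product_tri a b : H (tri_mx a b) <-> A a /\ B b.
Proof.
case: AB => _ _ HE; split=> [/HE[a' [b' [? ? /tri_mx_inj[-> ->]]]] //|[? ?]].
by apply/HE; exists a, b.
Qed.

Lemma separated_point z : ~ (exists c, z = iM c) ->
  exists (E : fieldType) (dE : option 'I_m -> E -> E) (f g : {rmorphism M -> E}),
    [/\ commuting_derivations dE, diff_compatible dM dE f,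
        diff_compatible dM dE g, forall c, f (iM c) = g (iM c) & f z <> g z].
Proof.
case: ppvM => derM comp _ _; case: derK => -[dKder _] _ _ _ _.
apply: separating_embeddings dKder derM comp.
exact: (fmorph_char0 (@tofrac _ \o polyC : {rmorphism F -> ratfield F})).
Qed.

Lemma dlog_eta_base c : annihilating_der dF A c ->
  exists k, drow kap (dPi dM) c eta / eta = iM k.
Proof.
move=> Ac; apply: contrapT => nK.
have [|E [dE [f [g [derE fd gd fgK fg]]]]] := @separated_point (drow kap (dPi dM) c eta / eta).
  by case=> k kE; apply: nK; exists k.
have eta0 := eta_neq0 basisM.
have [feta geta] : f eta != 0 /\ g eta != 0 by rewrite !fmorph_eq0.
pose phi := f \o kap.
have derc : derivation (drow phi (dPi dE) c) by apply: drow_der => l; exact: derE.1.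
pose a := g eta / f eta; pose b := (g xi - a^-1 * f xi) / f eta.
(* c(a) = a (g(z) - f(z)) for z = c(eta)/eta, an element that [f] and [g] separate. *)
have Da : drow phi (dPi dE) c a != 0.
  rewrite der_div //.
  have -> : drow phi (dPi dE) c (g eta) = g (drow kap (dPi dM) c eta).
    rewrite (@rmorph_drow _ _ _ _ _ _ (dPi dE)); first by apply: eq_drow => x; apply: fgK.
    by move=> l x; exact: gd.
  have -> : drow phi (dPi dE) c (f eta) = f (drow kap (dPi dM) c eta).
    by rewrite (@rmorph_drow _ _ _ _ _ _ (dPi dE)) // => l x; exact: fd.
  rewrite -!fmorph_div mulf_neq0 // ?mulf_neq0 ?invr_eq0 // subr_eq0.
  by apply/eqP => /esym.
have [|a0 [b0 [Hab]]] := galois_point closedF derK ppvM basisM etaE xi_eta derE fd gd fgK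
    (t := dcomb c (DVar _ _ 0)).
  by rewrite deval_dcomb //= ?rmorph0.
rewrite deval_dcomb // => /eqP; apply.
by have /triangular_product_tri[/Ac] := Hab.
Qed.

Lemma annihilating_op_base t :
  lin_op (annihilating_der dF A) t ->
  (forall b, B b -> deval id dF (fun=> b) t = 0) ->
  exists k, eta ^+ 2 * deval kap (dPi dM) (fun=> xi / eta) t = iM k.
Proof.
move=> tA tB; apply: contrapT => nK.
set Tz := deval kap _ _ t in nK *.
have [|E [dE [f [g [derE fd gd fgK fg]]]]] := @separated_point (eta ^+ 2 * Tz).
  by case=> k kE; apply: nK; exists k.
have eta0 := eta_neq0 basisM.
have [feta geta] : f eta != 0 /\ g eta != 0 by rewrite !fmorph_eq0.
pose phi := f \o kap.
have phi0 : phi 0 = 0 := rmorph0 (f \o kap : {rmorphism F -> E}).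
have gphi : g \o kap =1 phi by move=> c; apply/esym/fgK.
have derc c : derivation (drow phi (dPi dE) c) by apply: drow_der => l; exact: derE.1.
pose a := g eta / f eta; pose b := (g xi - a^-1 * f xi) / f eta.
have a0 : a != 0 by rewrite mulf_neq0 ?invr_eq0.
(* c(eta)/eta lies in K, where [f] and [g] agree. *)
have Da c : annihilating_der dF A c -> drow phi (dPi dE) c a = 0.
  move=> /dlog_eta_base[k kE]; rewrite der_div //.
  have -> : drow phi (dPi dE) c (g eta) = g (drow kap (dPi dM) c eta).
    rewrite (@rmorph_drow _ _ _ _ _ _ (dPi dE)); first by apply: eq_drow => x; apply: fgK.
    by move=> l x; exact: gd.
  have -> : drow phi (dPi dE) c (f eta) = f (drow kap (dPi dM) c eta).
    by rewrite (@rmorph_drow _ _ _ _ _ _ (dPi dE)) // => l x; exact: fd.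
  by rewrite -!fmorph_div kE fgK subrr mulr0.
have Dav c : annihilating_der dF A c -> drow phi (dPi dE) c a^-1 = 0.
  by move=> Ac; rewrite derV // Da // oppr0 mul0r.
pose T x := deval phi (dPi dE) (fun=> x) t.
have derE' l : derivation (dPi dE l) by exact: derE.1.
have TD x y : T (x + y) = T x + T y by exact: lin_opD phi0 derE' tA.
have TM x : T (a^-1 * x) = a^-1 * T x by exact: lin_opM phi0 derE' Dav tA.
have fT : f Tz = T (f (xi / eta)).
  by rewrite /Tz (@rmorph_deval _ _ _ _ _ _ _ (dPi dE)) // => l x; exact: fd.
have gT : g Tz = T (g (xi / eta)).
  rewrite /Tz (@rmorph_deval _ _ _ _ _ _ _ (dPi dE)); last by move=> l x; exact: gd.
  exact: eq_deval.
(* g(xi/eta) = a^-2 f(xi/eta) + a^-1 b and L commutes with a, so g(z) = f(z) + a f(eta)^2 L(b). The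
   factor eta^2 is there to absorb a^-2. *)
have Tb : T b != 0.
  apply/eqP => Tb; apply: fg; rewrite !(rmorphM, rmorphXn) gT.
  have -> : g (xi / eta) = a^-1 * (a^-1 * f (xi / eta)) + a^-1 * b.
    by rewrite /b /a !fmorph_div; field; rewrite feta geta.
  have gE : g eta = a * f eta by rewrite divfK.
  rewrite TD !TM Tb mulr0 addr0 -fT /= gE; move: (a) a0 => x x0.
  by field.
have [|a1 [b1 [Hab]]] := galois_point closedF derK ppvM basisM etaE xi_eta derE fd gd fgK
    (t := dsubst (fun=> DVar _ _ 1) t).
  by rewrite deval_subst.
rewrite deval_subst => /eqP; apply.
by have /triangular_product_tri[_ /tB] := Hab.
Qed.

Lemma triangular_product_scale a b : A a -> B b -> B (a * b).
Proof.
move=> Aa Bb; have B0 : B 0 by case: AB => _ [].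
have /gal_tri_mx[s [sbij sd sK [seta sxi]]] : H (tri_mx a 0).
  by apply/triangular_product_tri.
have /gal_tri_mx[s' [sbij' sd' sK' [seta' sxi']]] : H (tri_mx 1 b).
  apply/triangular_product_tri; split=> //.
  case: AB => -[_ + _ _ _] _ _; by rewrite mxE eqxx.
suff /triangular_product_tri[] : H (tri_mx a (a * b)) by [].
apply/gal_tri_mx; exists (s \o s'); split=> /=.
- exact: bij_comp.
- by move=> i x /=; rewrite sd' sd.
- by move=> c; rewrite sK' sK.
- have r1 : iM (ratC 1) = 1 by rewrite /ratC !rmorph1.
  have r0 : iM (ratC 0) = 0 by rewrite /ratC !rmorph0.
  have rM : iM (ratC (a * b)) = iM (ratC a) * iM (ratC b).
    by rewrite /ratC !rmorphM.
  rewrite seta' sxi' invr1 r1 !mul1r rmorphD rmorphM sK seta sxi r0 mul0r add0r rM.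
  by split=> //; ring.
Qed.

Lemma triangular_diag_neq0 a : A a -> a != 0.
Proof.
move=> Aa; have B0 : B 0 by case: AB => _ [].
have /gal_tri_mx[s [_ _ _ [+ _]]] : H (tri_mx a 0) by apply/triangular_product_tri.
apply: contra_eq_neq => ->; rewrite /ratC !rmorph0 mul0r fmorph_eq0.
exact: eta_neq0 basisM.
Qed.

(* The equations of [B] are linear and, [B] being stable by [A], can be chosen
   among the operators in the derivations killing [A]. *)
Lemma unipotent_part_closed b :
  (forall t, lin_op (annihilating_der dF A) t ->
    (forall b', B b' -> deval id dF (fun=> b') t = 0) ->
    deval id dF (fun=> b) t = 0) -> B b.
Proof.
move=> tb; case: AB => _ [B0 BB [S BS]] _; apply/BS => t St.
apply: (additive_linear_closure charF derF B0 BB) => [|b' /BS]; last exact.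
apply: (constant_killers charF derF triangular_diag_neq0 triangular_product_scale).
exact: tb.
Qed.

End Stabilizers.

(** * Restricting automorphisms to a differential subfield *)

Section Restriction.
Variables (I V : Type) (K M L : fieldType).
Variables (iM : {rmorphism K -> M}) (dM : I -> M -> M) (y : V -> M).
Variables (iL : {rmorphism K -> L}) (dL : I -> L -> L) (j : {rmorphism L -> M}).
Hypothesis defL : is_dgenerated_subfield iM dM y iL dL j.
Variable s : {rmorphism M -> M}.
Hypotheses (sd : diff_compatible dM dM s) (sK : forall c, s (iM c) = iM c).
Hypothesis sy : forall v, exists w, j w = s (y v).
Hypothesis ys : forall v, exists w, s (j w) = y v.

(** By [sy] the subfield is mapped into itself; [ys] puts the generators in the image, which gives
    surjectivity. *)
Lemma restrict_automorphism : exists s' : {rmorphism L -> L},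
  [/\ bijective s', diff_compatible dL dL s', forall c, s' (iL c) = iL c &
      forall z, j (s' z) = s (j z)].
Proof.
case: defL => jK jd jgen.
have imP z : exists w, j w = s (j z).
  have sub : dsubfield dM (fun x => exists w, j w = s x).
    split=> [|a b [w wE] [w' wE']|a b [w wE] [w' wE']|i a [w wE]].
    - by exists 1; rewrite !rmorph1.
    - by exists (w - w'); rewrite !rmorphB wE wE'.
    - by exists (w / w'); rewrite !fmorph_div wE wE'.
    - by exists (dL i w); rewrite jd sd wE.
  have genz : dgenerated iM dM y (j z) by apply/jgen; exists z.
  by apply: (genz _ sub _ sy) => c; exists (iL c); rewrite jK sK.
have [s0 s0E] := choice imP.
have jinj := fmorph_inj j.
have s0z : zmod_morphism s0 by move=> a b; apply: jinj; rewrite rmorphB !s0E !rmorphB.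
have s0m : monoid_morphism s0.
  split=> [|a b]; apply: jinj; first by rewrite s0E !rmorph1.
  by rewrite rmorphM !s0E !rmorphM.
pose s' := HB.pack_for {rmorphism L -> L} s0
  (GRing.isZmodMorphism.Build L L s0 s0z) (GRing.isMonoidMorphism.Build L L s0 s0m).
have surj z : exists x, s0 x = z.
  have sub : dsubfield dM (fun x => exists w, s (j w) = x).
    split=> [|a b [w wE] [w' wE']|a b [w wE] [w' wE']|i a [w wE]].
    - by exists 1; rewrite !rmorph1.
    - by exists (w - w'); rewrite !rmorphB wE wE'.
    - by exists (w / w'); rewrite !fmorph_div wE wE'.
    - by exists (dL i w); rewrite jd sd wE.
  have genz : dgenerated iM dM y (j z) by apply/jgen; exists z.
  have [|w wE] := genz _ sub _ ys; first by move=> c; exists (iL c); rewrite jK sK.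
  by exists w; apply: jinj; rewrite s0E.
have [t tK] := choice surj.
exists s'; split=> [|i a|c|z] /=.
- by exists t => // x; apply: (fmorph_inj s'); rewrite /= tK.
- by apply: jinj; rewrite s0E !jd sd s0E.
- by apply: jinj; rewrite s0E jK sK.
- exact: s0E.
Qed.

End Restriction.

Theorem theorem3p2
    (F : fieldType) (charF : [pchar F] =i pred0)
    (m : nat) (dF : 'I_m -> F -> F)
    (derF : commuting_derivations dF) (closedF : diff_closed dF)
    (dK : option 'I_m -> ratfield F -> ratfield F)
    (derK : is_ratfield_der dF dK)
    (q : ratfield F)
    (M : fieldType) (dM : option 'I_m -> M -> M)
    (iM : {rmorphism ratfield F -> M})
    (ppvM : is_PPV dK iM dM (coefs2 q))
    (eta xi : M)
    (basisM : solution_basis iM dM (coefs2 q) (pair2 eta xi))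
    (H : 'M[F]_2 -> Prop) (defH : H = gal_matrices iM dM (pair2 eta xi))
    (nredH : ~ reductive dF H)
    (eta_exp : exists u : ratfield F, dM None eta = iM u * eta)
    (xi_eta : dM None (xi / eta) = eta ^- 2)
    (A B : F -> Prop) (defA : A = diag_part H) (defB : B = unip_part H)
    (AB : is_triangular_product dF H A B)
    (k : nat) (P : 'M[F]_(k, m))
    (basisL : commuting_basis dF (annihilating_der dF A) P)
    (M' : fieldType) (dM' : option 'I_k -> M' -> M')
    (iM' : {rmorphism ratfield F -> M'}) (j : {rmorphism M' -> M})
    (defM' : is_dgenerated_subfield
               iM (der_comb_x P (fun a => iM (ratC a)) dM) (pair2 eta xi)
               iM' dM' j)
    (eta' xi' : M') (j_eta : j eta' = eta) (j_xi : j xi' = xi)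
    (H' : 'M[F]_2 -> Prop) (defH' : H' = gal_matrices iM' dM' (pair2 eta' xi'))
    (A' B' : F -> Prop) (defA' : A' = diag_part H') (defB' : B' = unip_part H') :
  (forall (i : 'I_k) (a : F), A' a -> der_comb P id dF i a = 0) /\
  (forall (s : nat) (p : 'I_s -> {mpoly F[k]}),
     defining_operators (der_comb P id dF) B' p ->
     defining_operators dF B (fun i => op_incl dF P (p i))).
Proof.
have [u etaE] := eta_exp; have [jK jd jgen] := defM'; have jinj := fmorph_inj j.
have [_ LP _] := basisL; have [derM _ _ _] := ppvM.
subst H H' A' B'.
pose kap : {rmorphism F -> M} := base_const iM.
pose dPi (i : 'I_m) := dM (Some i).
have dPi_der i : derivation (dPi i) by exact: derM.1.
have kap_d : diff_compatible dF dPi kap.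
  by move=> i a; exact/esym/(dM_base_const derK ppvM).
have eta0 := eta_neq0 basisM.
have jD i z : j (dM' (Some i) z) = drow kap dPi (row i P) (j z).
  by rewrite jd /= der_combE.
have rowL i : annihilating_der dF A (row i P) by apply/LP/row_sub.
have dlog := dlog_eta_base charF closedF derK ppvM basisM etaE xi_eta AB.
split=> [i a [b /gal_tri_mx[s' [_ s'd s'K [s'eta _]]]]|].
  have [w wE] := dlog _ (rowL i).
  (* The logarithmic derivative lies in K, so the equation descends to [M'] through the injective
     [j]. *)
  have Deta : dM' (Some i) eta' = iM' w * eta'.
    by apply: jinj; rewrite rmorphM jK jD j_eta -wE divfK.
  (* The two values are w a eta' and d(a) eta' + a w eta', whence d(a) = 0. *)
  have : s' (dM' (Some i) eta') = dM' (Some i) (s' eta') by rewrite s'd.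
  rewrite Deta rmorphM s'K s'eta => /(congr1 j).
  rewrite jD !rmorphM jK !jK j_eta (drow_der _ _ dPi_der).2.
  rewrite -[iM (ratC a)]/(kap a) -(rmorph_drow id (row i P) a kap_d).
  have -> : drow kap dPi (row i P) eta = iM w * eta by rewrite -wE divfK.
  move=> E; have /eqP : kap (drow id dF (row i P) a) * eta = 0.
    by apply: (addIr (kap a * (iM w * eta))); rewrite -E; ring.
  by rewrite mulf_eq0 (negPf eta0) orbF fmorph_eq0 der_combE => /eqP.
(* On [F] the included operators act as the original ones, so equality of the two groups
   suffices. *)
suff BB' b : B b <-> unip_part (gal_matrices iM' dM' (pair2 eta' xi')) b.
  move=> s p pB b; rewrite BB' pB; split=> pb i.
    by rewrite op_apply_incl.
  by rewrite -op_apply_incl.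
have r1 (R : fieldType) (h : {rmorphism ratfield F -> R}) : h (ratC 1) = 1.
  by rewrite /ratC !rmorph1.
split=> [|/gal_tri_mx[s' [_ s'd s'K [s'eta s'xi]]]].
  rewrite defB => /gal_tri_mx[s [_ sd sK [seta sxi]]].
  rewrite invr1 !r1 !mul1r in seta sxi.
  have sdx : diff_compatible (der_comb_x P (fun a => iM (ratC a)) dM)
      (der_comb_x P (fun a => iM (ratC a)) dM) s.
    case=> [i|] x /=; last exact: sd.
    rewrite rmorph_sum; apply: eq_bigr => l _.
    by rewrite rmorphM sK sd.
  have [||s' [s'bij s'd s'K js']] := restrict_automorphism defM' sdx sK.
  - apply: ord2_ind.
      by exists eta'; rewrite j_eta; exact/esym.
    exists (iM' (ratC b) * eta' + xi').
    by rewrite rmorphD rmorphM jK j_eta j_xi; exact/esym.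
  - apply: ord2_ind.
      by exists eta'; rewrite j_eta; exact: seta.
    exists (xi' - iM' (ratC b) * eta').
    rewrite rmorphB rmorphM jK j_eta j_xi rmorphB rmorphM sK seta sxi.
    by rewrite addrC addKr.
  apply/gal_tri_mx; exists s'; split=> //; rewrite invr1 !r1 !mul1r.
  split; apply: jinj; rewrite js' ?j_eta ?j_xi ?seta ?sxi //.
  by rewrite rmorphD rmorphM jK j_eta j_xi.
rewrite invr1 !r1 !mul1r in s'eta s'xi.
apply: (unipotent_part_closed charF derF basisM AB) => t tA tB.
have [w wE] := annihilating_op_base charF closedF derK ppvM basisM etaE xi_eta AB tA tB.
pose T x := deval kap dPi (fun=> x) t.
(* [T'] is the operator [t] acting on [M']: derivations killing [A] are F-combinations of Pi', so
   they act there and commute with [s']. *)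
have [T' T'P] : exists T' : M' -> M', forall z, j (T' z) = T (j z) /\ s' (T' z) = T' (s' z).
  rewrite {}/T; elim: tA => [|s1 s2 _ [T1 H1] _ [T2 H2]|c s1 _ [T1 H1]|c s1 Lc _ [T1 H1]].
  - by exists id.
  - exists (fun z => T1 z + T2 z) => z /=; have [? e1] := H1 z; have [? e2] := H2 z.
    by split; rewrite rmorphD; congr (_ + _).
  - exists (fun z => iM' (ratC c) * T1 z) => z /=; have [e0 e1] := H1 z.
    by rewrite !rmorphM s'K e1 jK e0.
  - have /LP/submxP[U cU] := Lc.
    exists (fun z => \sum_l iM' (ratC (U 0 l)) * dM' (Some l) (T1 z)) => z.
    have [e0 e1] := H1 z; rewrite !rmorph_sum; split.
      rewrite deval_dcomb ?rmorph0 // cU drow_submx; apply: eq_bigr => l _.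
      by rewrite rmorphM jK jD e0 der_combE.
    by apply: eq_bigr => l _; rewrite rmorphM s'K s'd e1.
have jT z : j (T' z) = T (j z) by case: (T'P z).
have eta'0 : eta' != 0 by rewrite -(fmorph_eq0 j) j_eta.
(* This element comes from K and is fixed, while [s'] fixes eta' and translates xi'/eta' by b;
   additivity of the operator leaves its value at b equal to 0. *)
have fixed : s' (eta' ^+ 2 * T' (xi' / eta')) = eta' ^+ 2 * T' (xi' / eta').
  rewrite (_ : _ * _ = iM' w) ?s'K //; apply: jinj.
  by rewrite jK rmorphM rmorphXn jT fmorph_div j_eta j_xi.
move: fixed; rewrite rmorphM rmorphXn s'eta (T'P _).2.
move/(mulfI (expf_neq0 2 eta'0))/(congr1 j).
rewrite !jT !fmorph_div s'eta s'xi rmorphD rmorphM jK j_eta j_xi mulrDl mulfK //.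
rewrite /T (lin_opD _ _ (rmorph0 kap) dPi_der tA) => E.
apply/eqP; rewrite -(fmorph_eq0 kap); apply/eqP.
rewrite (rmorph_deval _ _ _ kap_d).
by apply: (addIr (deval kap dPi (fun=> xi / eta) t)); rewrite add0r -[RHS]E.
Qed.
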